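(* There exists a constant $c>0$ such that, with probability $1-o(1)$ as $n\to\infty$ over $G\leftarrow G(n,1/2)$, the matrix $M_G$ is positive semidefinite for $k\le 2^{-cr}\cdot(\sqrt{n}/\log n)^{1/r}$.
   Context: $G(n,1/2)$ is the random graph on vertex set $[n]$ with each pair an edge independently with probability $1/2$. For a graph $G$ on $[n]$, a positive integer $r$ and $I\subseteq[n]$ with $|I|\le 2r$, let $\deg_G(I)$ be the number of sets $S\subseteq[n]$ with $I\subseteq S$, $|S|=2r$ and $S$ a clique in $G$. The matrix $M_G$ has rows and columns indexed by the $r$-element subsets of $[n]$, with entries $M_G(I,J)=\deg_G(I\cup J)\cdot\binom{k}{|I\cup J|}\Big/\binom{2r}{|I\cup J|}$. *)

(* Defs.v *)
From mathcomp Require Export all_boot all_order all_algebra.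
From mathcomp Require Export all_classical all_reals all_analysis.

Set Implicit Arguments.
Unset Strict Implicit.
Unset Printing Implicit Defensive.

Export Order.TTheory GRing.Theory Num.Theory.
Export numFieldNormedType.Exports.

Local Open Scope ring_scope.

(* A simple graph on 'I_n is represented by its edge set, a subset of
   [pairs n]. *)
Definition pairs (n : nat) : {set {set 'I_n}} := [set e : {set 'I_n} | #|e| == 2%N]%SET.

Definition gnp_weight (R : realType) (n : nat) (p : R)
    (G : {set {set 'I_n}}) : R :=
  \prod_(e in pairs n) (if e \in G then p else 1 - p).

Definition gnp_Pr (R : realType) (n : nat) (p : R)
    (A : {set {set 'I_n}} -> Prop) : R :=
  \sum_(G : {set {set 'I_n}} | (G \subset pairs n) && `[< A G >])
    gnp_weight p G.

Definition clique (n : nat) (G : {set {set 'I_n}}) (S : {set 'I_n}) : bool :=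
  [forall x in S, forall y in S, (x != y) ==> ([set x; y]%SET \in G)].

Definition deg (n r : nat) (G : {set {set 'I_n}}) (I : {set 'I_n}) : nat :=
  #|[set S : {set 'I_n} | [&& I \subset S, #|S| == (2 * r)%N & clique G S]]%SET|.

Definition rsets (n r : nat) : {set {set 'I_n}} := [set I : {set 'I_n} | #|I| == r]%SET.

(* Row and column i stand for the r-subset [enum_val i]. *)
Definition MG (R : realType) (n r k : nat) (G : {set {set 'I_n}}) :
    'M[R]_(#|rsets n r|) :=
  \matrix_(i, j)
    let U := (enum_val i :|: enum_val j)%SET in
    (deg r G U)%:R * 'C(k, #|U|)%:R / 'C(2 * r, #|U|)%:R.

Definition psdmx (R : realType) (m : nat) (A : 'M[R]_m) : Prop :=
  A^T = A /\ forall x : 'cV[R]_m, 0 <= (x^T *m A *m x) 0 0.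

(* Main.v *)
(* Write g(x,y) for the edge indicator, so g(x,x) = 0, and a = g - 1/2.  Up to
   the factor (2r)!, the quadratic form of M_G at x is
     sum over r-subsets P, Q of the 2r positions of beta(|P u Q|) *
     sum over all s : [2r] -> [n] of [s is a clique] f(s P) f(s Q),
   where f is x restricted to cliques and beta(i) = C(k,i) / C(2r,i).
   In [s is a clique], the edges inside P or inside Q come for free from f.
   Every remaining edge, except those joining P n Q to the complement of P u Q,
   is replaced by 1/2.  The resulting errors are sums of
   a(s_p, s_q) phi(s) psi(s) with phi independent of s_q and psi independent of
   s_p, so each is at most ||a|| / n times (sum f(s P)^2 + sum f(s Q)^2); since
   a(x,x) = -1/2 this also accounts for non-injective s.  What is left is a sum
   of squares, and for P = Q it is at least (d/n)^r sum f(s P)^2, where d bounds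
   from below the number of common neighbours of an r-set.  Random input is thus
   only needed for d >= n / 2^(r+3) and ||a|| = O(sqrt n log n).  The latter
   follows from the cut bound |a(S,T)| = O(sqrt(n |S| |T|)): if all partial sums
   satisfy |sum_S l| <= kap sqrt |S|, the i-th largest |l| is at most
   2 kap / sqrt i, so |l|^2 = O(kap^2 log n). *)
From mathcomp Require Import fingroup perm.
Require Import Defs.
From mathcomp Require Import ring lra zify.

Set Implicit Arguments.
Unset Strict Implicit.
Unset Printing Implicit Defensive.

Local Open Scope ring_scope.

(** * Operator norm from a cut bound *)

(** This is exp(-x) >= 1 - x at x = 1/(m+1), since m/(m+1) = 1 - x. It bounds harmonic sums by 1 +
    ln one term at a time. *)
Lemma ln_succ_gap (R : realType) (m : nat) : (0 < m)%N ->
  m.+1%:R^-1 + ln m%:R <= ln m.+1%:R :> R.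
Proof.
move=> m0.
have m0R : 0 < m%:R :> R by rewrite ltr0n.
have m1R : 0 < m.+1%:R :> R by rewrite ltr0n.
rewrite -lerBrDr -ln_div ?posrE//.
rewrite -ler_expR lnK ?posrE ?divr_gt0//.
rewrite -[m.+1%:R^-1]opprK expRN -[leRHS]invrK invf_div.
rewrite lef_pV2 ?posrE ?expR_gt0 ?divr_gt0//.
apply: le_trans (expR_ge1Dx _).
rewrite ler_pdivrMr// mulrDl mul1r mulNr mulVf ?gt_eqF//.
by rewrite -natr1; lra.
Qed.

(** Induction removing a smallest element: it is at most the mean over S, hence at most kap / sqrt
    |S|, so its square costs kap^2 / |S|. The costs form a harmonic sum. *)
Lemma sum_sqr_weak_nonneg (R : realType) (T : finType) (l : T -> R) (kap : R) :
  (forall x, 0 <= l x) ->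
  (forall S : {set T}, \sum_(x in S) l x <= kap * Num.sqrt #|S|%:R) ->
  forall m (S : {set T}), #|S| = m.+1 ->
    \sum_(x in S) l x ^+ 2 <= kap ^+ 2 * (1 + ln m.+1%:R).
Proof.
move=> l0 lS; elim=> [|m IH] S Sm.
  have /eqP/cards1P[x ->] := Sm.
  rewrite big_set1 ln1 addr0 mulr1.
  have := lS [set x]; rewrite big_set1 cards1 sqrtr1 mulr1.
  by move=> h; rewrite lerXn2r ?nnegrE//; apply: le_trans h.
have /card_gt0P[x0 x0S] : (0 < #|S|)%N by rewrite Sm.
have [x xS xmin] : exists2 x, x \in S & forall y, y \in S -> l x <= l y.
  by case: (arg_minP l x0S) => x xS xmin; exists x.
rewrite (big_setD1 x)//=.
have Sxm : #|S :\ x| = m.+1 by have := cardsD1 x S; rewrite xS Sm => -[].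
have ih := IH _ Sxm.
have hx : l x ^+ 2 <= kap ^+ 2 / m.+2%:R.
  have h : m.+2%:R * l x <= kap * Num.sqrt m.+2%:R.
    have := lS S; rewrite Sm; apply: le_trans.
    rewrite -Sm -sum1_card natr_sum mulr_suml; apply: ler_sum => y yS.
    by rewrite mul1r xmin.
  have h2 : (m.+2%:R * l x) ^+ 2 <= (kap * Num.sqrt m.+2%:R) ^+ 2.
    have h0 : 0 <= m.+2%:R * l x by rewrite mulr_ge0.
    by rewrite lerXn2r// nnegrE; apply: le_trans h.
  move: h2; rewrite !exprMn sqr_sqrtr// => h2.
  rewrite ler_pdivlMr ?ltr0n// -(ler_pM2r (_ : 0 < m.+2%:R)) ?ltr0n//.
  by apply: le_trans h2; rewrite le_eqVlt; apply/orP; left; apply/eqP; ring.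
have gap := @ln_succ_gap R m.+1 isT.
have : kap ^+ 2 * (m.+2%:R^-1 + ln m.+1%:R) <= kap ^+ 2 * ln m.+2%:R.
  by rewrite ler_wpM2l// sqr_ge0.
rewrite mulrDr => h.
apply: le_trans (lerD hx ih) _.
rewrite !mulrDr; move: h.
by move: (kap ^+ 2 / _) (kap ^+ 2 * ln _) (kap ^+ 2 * ln _) (kap ^+ 2 * 1) => *; lra.
Qed.

Lemma sum_sqr_weak (R : realType) (T : finType) (l : T -> R) (kap : R) :
  (0 < #|T|)%N ->
  (forall S : {set T}, `|\sum_(x in S) l x| <= kap * Num.sqrt #|S|%:R) ->
  \sum_x l x ^+ 2 <= 4 * kap ^+ 2 * (1 + ln #|T|%:R).
Proof.
move=> T0 lS.
have kap0 : 0 <= kap.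
  have /card_gt0P[x _] := T0.
  have := lS [set x]; rewrite cards1 sqrtr1 mulr1; exact: le_trans.
(* The nonnegative and the negative entries in S each obey the signed bound on a subset of S; adding
   the two doubles [kap]. *)
have absS (S : {set T}) : \sum_(x in S) `|l x| <= (2 * kap) * Num.sqrt #|S|%:R.
  have part (Pr : pred T) : `|\sum_(x in S | Pr x) l x| <= kap * Num.sqrt #|S|%:R.
    rewrite (eq_bigl (mem [set x in S | Pr x])); last by move=> x; rewrite !inE.
    apply: le_trans (lS [set x in S | Pr x]) _.
    rewrite ler_wpM2l// ler_sqrt ?ler0n// ler_nat subset_leq_card//.
    by apply/fintype.subsetP => y; rewrite inE => /andP[].
  rewrite (bigID (fun x => 0 <= l x))/=.
  rewrite (eq_bigr l); last by move=> x /andP[_ /ger0_norm].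
  rewrite [X in _ + X <= _](eq_bigr (fun x => - l x)); last first.
    by move=> x /andP[_]; rewrite -ltNge => /ltr0_norm.
  rewrite sumrN.
  have := part (fun x => 0 <= l x); have := part (fun x => ~~ (0 <= l x)).
  rewrite !ler_norml => /andP[? ?] /andP[? ?]; lra.
have -> : \sum_x l x ^+ 2 = \sum_(x in [set: T]) `|l x| ^+ 2.
  by apply: eq_big => [x|x _]; rewrite ?inE// real_normK ?num_real.
have -> : 4 * kap ^+ 2 = (2 * kap) ^+ 2 by rewrite exprMn; congr (_ * _); lra.
have := @sum_sqr_weak_nonneg R T (fun x => `|l x|) (2 * kap) (fun=> normr_ge0 _) absS #|T|.-1 [set: T].
by rewrite prednK// cardsT; apply.
Qed.

(** Cauchy-Schwarz, from the Lagrange identity. *)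
Lemma sum_mul_sqr_le (R : realType) (T : finType) (u v : T -> R) :
  (\sum_x u x * v x) ^+ 2 <= (\sum_x u x ^+ 2) * (\sum_x v x ^+ 2).
Proof.
have : 0 <= \sum_x \sum_y (u x * v y - u y * v x) ^+ 2.
  by do 2 (apply: sumr_ge0 => ? _); exact: sqr_ge0.
have -> : \sum_x \sum_y (u x * v y - u y * v x) ^+ 2 =
    2 * ((\sum_x u x ^+ 2) * (\sum_x v x ^+ 2)) - 2 * (\sum_x u x * v x) ^+ 2.
  have e1 : \sum_x \sum_y u x ^+ 2 * v y ^+ 2 = (\sum_x u x ^+ 2) * (\sum_x v x ^+ 2).
    by rewrite mulr_suml; apply: eq_bigr => x _; rewrite mulr_sumr.
  have e2 : \sum_x \sum_y (u x * v x) * (u y * v y) = (\sum_x u x * v x) ^+ 2.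
    by rewrite expr2 mulr_suml; apply: eq_bigr => x _; rewrite mulr_sumr.
  rewrite (_ : 2 * (_ * _) = \sum_x \sum_y u x ^+ 2 * v y ^+ 2
    + \sum_y \sum_x u x ^+ 2 * v y ^+ 2); last first.
    by rewrite [X in _ + X]exchange_big/= e1; ring.
  rewrite -e2 mulr_sumr -big_split -sumrB; apply: eq_bigr => x _ /=.
  rewrite mulr_sumr -big_split -sumrB; apply: eq_bigr => y _ /=.
  by ring.
lra.
Qed.

(** [sum_sqr_weak] is used twice. For fixed S2 it turns the cut bound into an l2 bound on the row
    sums over S2. Cauchy-Schwarz against u then bounds the partial sums of y |-> sum_x a x y * u x,
    and the second use bounds the l2 norm of that vector. *)
Lemma bilinear_of_cut (R : realType) (T : finType) (a : T -> T -> R) (kap : R) :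
  (0 < #|T|)%N -> 0 < kap ->
  (forall S1 S2 : {set T}, `|\sum_(x in S1) \sum_(y in S2) a x y|
      <= kap * Num.sqrt #|S1|%:R * Num.sqrt #|S2|%:R) ->
  forall u v : T -> R, `|\sum_x \sum_y a x y * u x * v y| <=
    2 * kap * (1 + ln #|T|%:R) * (\sum_x u x ^+ 2 + \sum_y v y ^+ 2).
Proof.
move=> T0 kap0 cut u v.
set H := 1 + ln _.
have H0 : 0 < H by rewrite /H ltr_pwDl// ln_ge0// ler1n.
have l1 (S2 : {set T}) : \sum_x (\sum_(y in S2) a x y) ^+ 2 <= 4 * kap ^+ 2 * H * #|S2|%:R.
  have := @sum_sqr_weak R T (fun x => \sum_(y in S2) a x y) (kap * Num.sqrt #|S2|%:R) T0.
  rewrite exprMn sqr_sqrtr// -/H; move=> h.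
  have {}h := h (fun S => le_trans (cut S S2) (eqbRL (le_eqVlt _ _) _)).
  rewrite [leRHS](_ : _ = 4 * (kap ^+ 2 * #|S2|%:R) * H); last by ring.
  by apply: h => S; apply/orP; left; apply/eqP; ring.
pose K := 4 * kap * H.
have K0 : 0 < K by rewrite /K !mulr_gt0.
have l2 : \sum_y (\sum_x a x y * u x) ^+ 2 <= K ^+ 2 * \sum_x u x ^+ 2.
  set U := \sum_x u x ^+ 2.
  have U0 : 0 <= U by apply: sumr_ge0 => x _; exact: sqr_ge0.
  have sq4 : Num.sqrt (4 * kap ^+ 2 * H * U) ^+ 2 = 4 * kap ^+ 2 * H * U.
    by rewrite sqr_sqrtr// !mulr_ge0// ?sqr_ge0// ltW.
  have := @sum_sqr_weak R T (fun y => \sum_x a x y * u x) (Num.sqrt (4 * kap ^+ 2 * H * U)) T0.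
  rewrite sq4 -/H => h.
  rewrite [leRHS](_ : _ = 4 * (4 * kap ^+ 2 * H * U) * H); last by rewrite /K; ring.
  apply: h => S; rewrite exchange_big/=.
  rewrite -sqrtrM; last by rewrite !mulr_ge0// ?sqr_ge0// ltW.
  rewrite -[leLHS]sqrtr_sqr.
  rewrite ler_sqrt; last by rewrite !mulr_ge0// ?sqr_ge0// ltW.
  rewrite ?real_normK ?num_real//.
  under eq_bigr do under eq_bigr do rewrite mulrC.
  under eq_bigr do rewrite -mulr_sumr.
  apply: le_trans (sum_mul_sqr_le _ _) _.
  have := ler_wpM2l U0 (l1 S); rewrite -/U; lra.
have -> : \sum_x \sum_y a x y * u x * v y = \sum_y (\sum_x a x y * u x) * v y.
  by rewrite exchange_big/=; apply: eq_bigr => y _; rewrite mulr_suml.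
set U := \sum_x u x ^+ 2 in l2 *; set V := \sum_y v y ^+ 2.
(* The weights are balanced for p of l2 norm at most K times that of u, so that u and v both end
   with coefficient K / 2. *)
have amgm p q : `|p * q| <= K / 2 * q ^+ 2 + (2 * K)^-1 * p ^+ 2 :> R.
  have -> : p * q = K * ((p / K) * q) by field; rewrite gt_eqF.
  have -> : (2 * K)^-1 * p ^+ 2 = K / 2 * (p / K) ^+ 2 by field; rewrite gt_eqF.
  move: (p / K) => z; rewrite normrM gtr0_norm// -mulrDr -mulrA ler_pM2l//.
  rewrite ler_norml; have := sqr_ge0 (z + q); have := sqr_ge0 (z - q).
  by move=> ? ?; apply/andP; split; nra.
apply: le_trans (ler_norm_sum _ _ _) _.
apply: le_trans (ler_sum _ (fun y _ => amgm _ _)) _.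
rewrite big_split/= -!mulr_sumr -/V.
have h : (2 * K)^-1 * \sum_y (\sum_x a x y * u x) ^+ 2 <= K / 2 * U.
  rewrite ler_pdivrMl ?mulr_gt0//; apply: le_trans l2 _.
  by rewrite le_eqVlt; apply/orP; left; apply/eqP; field.
have -> : 2 * kap * H = K / 2 by rewrite /K; field.
by rewrite mulrDr addrC lerD.
Qed.

(** * Replacing edges by their mean *)

Definition merge (I V : finType) (X : {set I}) (s t : {ffun I -> V}) : {ffun I -> V} :=
  [ffun i => if i \in X then t i else s i].

Lemma mergeE (I V : finType) (X : {set I}) (s t : {ffun I -> V}) i :
  merge X s t i = if i \in X then t i else s i.
Proof. by rewrite ffunE. Qed.

Definition upd (I V : finType) (s : {ffun I -> V}) (p : I) (x : V) : {ffun I -> V} :=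
  [ffun i => if i == p then x else s i].

Definition indep (I V : finType) (T : Type) (X : {set I}) (F : {ffun I -> V} -> T) :=
  forall s t : {ffun I -> V}, (forall i, i \notin X -> s i = t i) -> F s = F t.

(** Exchanging the coordinates of s and t in X is an involution on pairs, so resampling X from an
    independent t preserves the uniform measure. *)
Lemma sum_merge (R : realType) (I V : finType) (X : {set I}) (F : {ffun I -> V} -> R) :
  \sum_s \sum_t F (merge X s t) = #|{ffun I -> V}|%:R * \sum_s F s.
Proof.
pose h (p : {ffun I -> V} * {ffun I -> V}) := (merge X p.1 p.2, merge X p.2 p.1).
have hK : involutive h.
  move=> [s t]; congr pair; apply/ffunP => i; rewrite /h /= !ffunE;
  by case: (i \in X).
rewrite pair_big /= (reindex_inj (inv_inj hK)) /=.
rewrite (eq_bigr (fun p : {ffun I -> V} * {ffun I -> V} => F p.1)); last first.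
  by move=> p _; congr F; have := hK p; rewrite [p in _ = p]surjective_pairing => -[].
rewrite -(pair_big xpredT xpredT (fun s _ => F s)) /= mulr_sumr.
by apply: eq_bigr => s _; rewrite sumr_const mulr_natl.
Qed.

Lemma sum_upd (R : realType) (I V : finType) (p : I) (F : {ffun I -> V} -> R) :
  \sum_s \sum_x F (upd s p x) = #|V|%:R * \sum_s F s.
Proof.
pose h (q : {ffun I -> V} * V) := (upd q.1 p q.2, q.1 p).
have hK : involutive h.
  move=> [s x]; congr pair; rewrite /h /= ?ffunE ?eqxx//; apply/ffunP => i.
  by rewrite !ffunE; case: eqP => // ->.
rewrite pair_big /= (reindex_inj (inv_inj hK)) /=.
rewrite (eq_bigr (fun q : {ffun I -> V} * V => F q.1)); last first.
  by move=> q _; congr F; have := hK q; rewrite [q in _ = q]surjective_pairing => -[].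
rewrite -(pair_big xpredT xpredT (fun s _ => F s)) /= mulr_sumr.
by apply: eq_bigr => s _; rewrite sumr_const mulr_natl.
Qed.

(** Rescaling u and v against each other shows that this says operator norm at most 2K. The additive
    form can be summed directly over the remaining coordinates. *)
Definition bilinear_bound (R : realType) (V : finType) (a : V -> V -> R) (K : R) :=
  forall u v : V -> R,
    `|\sum_x \sum_y a x y * u x * v y| <= K * (\sum_x u x ^+ 2 + \sum_y v y ^+ 2).

(** Resample the coordinates p and q. With the others frozen, phi is a function of the value at p
    alone and psi of the value at q alone, so the bilinear bound applies for each s. *)
Lemma masked_sum_bound (R : realType) (I V : finType) (a : V -> V -> R) (K : R)
    (p q : I) (phi psi : {ffun I -> V} -> R) :
  (0 < #|V|)%N -> bilinear_bound a K -> p != q ->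
  indep [set q] phi -> indep [set p] psi ->
  #|V|%:R * `|\sum_(s : {ffun I -> V}) a (s p) (s q) * phi s * psi s|
    <= K * (\sum_s phi s ^+ 2 + \sum_s psi s ^+ 2).
Proof.
move=> V0 aK pq iphi ipsi; set Z := \sum_s _; set n := #|V|%:R.
have n0 : 0 < n by rewrite ltr0n.
have nnZ : n * (n * Z) =
    \sum_s \sum_x \sum_y a x y * phi (upd s p x) * psi (upd s q y).
  rewrite /Z -(sum_upd q) -(sum_upd p); apply: eq_bigr => s _.
  apply: eq_bigr => x _; apply: eq_bigr => y _.
  rewrite !ffunE eqxx (negbTE pq) eqxx; congr (_ * _ * _).
    by apply: iphi => i; rewrite inE => iq; rewrite !ffunE (negbTE iq).
  by apply: ipsi => i; rewrite inE => ip; rewrite !ffunE (negbTE ip).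
have : `|n * (n * Z)| <= K * (n * (\sum_s phi s ^+ 2 + \sum_s psi s ^+ 2)).
  rewrite nnZ mulrDr -(sum_upd p (fun s => phi s ^+ 2)) -(sum_upd q (fun s => psi s ^+ 2)).
  rewrite -big_split mulr_sumr; apply: le_trans (ler_norm_sum _ _ _) _.
  by apply: ler_sum => s _; exact: aK.
by rewrite !normrM gtr0_norm// [K * _]mulrCA ler_pM2l.
Qed.

Definition touches (I : eqType) (i : I) (e : I * I) : bool := (i == e.1) || (i == e.2).

Definition edge_prod (R : realType) (I V : finType) (g : rel V) (M : seq (I * I))
    (s : {ffun I -> V}) : R :=
  \prod_(e <- M) (g (s e.1) (s e.2))%:R.

(** The edges of [ell] are replaced by 1/2 one at a time. Each replacement costs one masked sum; the
    other edge factors lie in [0, 1], so absorbing them into phi and psi does not increase the sums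
    of squares. *)
Lemma telescope (R : realType) (I V : finType) (g : rel V) (K : R)
    (phi psi : {ffun I -> V} -> R) (ell base : seq (I * I)) :
  (0 < #|V|)%N -> bilinear_bound (fun x y => (g x y)%:R - 2^-1) K ->
  uniq (ell ++ base) ->
  {in ell, forall e, [/\ e.1 != e.2, indep [set e.2] phi & indep [set e.1] psi]} ->
  {in ell & ell ++ base, forall e e', e' != e -> ~~ (touches e.1 e' && touches e.2 e')} ->
  #|V|%:R * `|\sum_s edge_prod R g ell s * edge_prod R g base s * phi s * psi s
     - 2^-1 ^+ size ell * \sum_s edge_prod R g base s * phi s * psi s|
  <= (size ell)%:R * (K * (\sum_s phi s ^+ 2 + \sum_s psi s ^+ 2)).
Proof.
move=> V0 gK; set G := edge_prod R g; elim: ell => [|e l IH] /=.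
  move=> _ _ _; rewrite expr0 mul1r mul0r.
  rewrite (eq_bigr (fun s => G base s * phi s * psi s)) ?subrr ?normr0 ?mulr0//.
  by move=> s _; rewrite {1}/G /edge_prod big_nil mul1r.
move=> /andP[eM uM] ind sep.
have /= [e12 iphi ipsi] := ind e (mem_head _ _).
set W := \sum_s G base s * phi s * psi s.
have {}IH := IH uM
  (fun x xl => ind x (mem_behead (s := e :: l) xl))
  (fun x y xl yl => sep x y (mem_behead (s := e :: l) xl) (mem_behead (s := e :: (l ++ base)) yl)).
pose M := l ++ base.
(* No factor meets both ends of [e], so those meeting [e.2] can go to [psi']
   and the others to [phi']. *)
pose phi' (s : {ffun I -> V}) := \prod_(e' <- M | ~~ touches e.2 e') (g (s e'.1) (s e'.2))%:R * phi s.
pose psi' (s : {ffun I -> V}) := \prod_(e' <- M | touches e.2 e') (g (s e'.1) (s e'.2))%:R * psi s.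
have prod01 (s : {ffun I -> V}) (Pr : pred (I * I)) :
    0 <= (\prod_(e' <- M | Pr e') (g (s e'.1) (s e'.2))%:R : R) <= 1.
  apply/andP; split; first by apply: prodr_ge0 => *; rewrite ler0n.
  by apply: prodr_ile1 => e' _; rewrite ler0n lern1 leq_b1.
have sqle s (c x : R) : 0 <= c <= 1 -> (c * x) ^+ 2 <= x ^+ 2.
  move=> /andP[c0 c1]; rewrite exprMn ler_piMl ?sqr_ge0//.
  by rewrite expr_le1.
have iphi' : indep [set e.2] phi'.
  move=> s t st; rewrite /phi' (iphi s t st); congr (_ * _).
  apply: eq_bigr => e'; rewrite /touches negb_or ![e.2 == _]eq_sym => /andP[h1 h2].
  by rewrite !st// !inE.
have ipsi' : indep [set e.1] psi'.
  move=> s t st; rewrite /psi' (ipsi s t st); congr (_ * _).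
  rewrite big_seq_cond [RHS]big_seq_cond; apply: eq_bigr => e' /andP[e'M te'].
  have e'e : e' != e by apply: contraNneq eM => <-.
  have := sep e e' (mem_head _ _) (mem_behead (s := e :: M) e'M) e'e.
  rewrite te' andbT /touches negb_or ![e.1 == _]eq_sym => /andP[h1 h2].
  by rewrite !st// !inE.
have first := masked_sum_bound V0 gK e12 iphi' ipsi'.
have sphi : \sum_s phi' s ^+ 2 <= \sum_s phi s ^+ 2.
  by apply: ler_sum => s _; apply: sqle.
have spsi : \sum_s psi' s ^+ 2 <= \sum_s psi s ^+ 2.
  by apply: ler_sum => s _; apply: sqle.
(* Testing the bound on the indicator of a point gives 0 <= 2K. *)
have K0 : 0 <= K.
  have /card_gt0P[v _] := V0.
  have := gK (fun x => (x == v)%:R) (fun x => (x == v)%:R).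
  have -> : \sum_x ((x == v)%:R : R) ^+ 2 = 1.
    by rewrite (bigD1 v)//= eqxx expr1n big1 ?addr0// => x /negbTE ->; rewrite expr0n.
  move=> /(le_trans (normr_ge0 _)); rewrite pmulr_lge0//; lra.
set D := K * _ in IH *.
have {}first : #|V|%:R * `|\sum_(s : {ffun I -> V}) ((g (s e.1) (s e.2))%:R - 2^-1) * phi' s * psi' s| <= D.
  by apply: le_trans first _; rewrite ler_wpM2l// lerD.
(* Write the factor of [e] as (g - 1/2) + 1/2: the first part is the masked sum, the second is half
   of the induction hypothesis. *)
have -> : \sum_s G (e :: l) s * G base s * phi s * psi s - 2^-1 ^+ (size l).+1 * W =
   \sum_(s : {ffun I -> V}) ((g (s e.1) (s e.2))%:R - 2^-1) * phi' s * psi' s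
   + 2^-1 * (\sum_s G l s * G base s * phi s * psi s - 2^-1 ^+ (size l) * W).
  rewrite exprS mulrBr mulrA addrA; congr (_ - _).
  rewrite mulr_sumr -big_split; apply: eq_bigr => s _ /=.
  have GM : G l s * G base s = \prod_(e' <- M | ~~ touches e.2 e') (g (s e'.1) (s e'.2))%:R
     * \prod_(e' <- M | touches e.2 e') (g (s e'.1) (s e'.2))%:R.
    by rewrite /G /edge_prod -big_cat/= (bigID (touches e.2)) mulrC.
  rewrite {1}/G /edge_prod big_cons -/(G l s) -mulrA -[_ * G base s]mulrA GM /phi' /psi'.
  by ring.
apply: le_trans (ler_wpM2l (ler0n _ _) (ler_normD _ _)) _.
rewrite mulrDr -[in X in _ <= X](natr1 (size l)) mulrDl mul1r [leRHS]addrC; apply: lerD => //.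
rewrite normrM ger0_norm ?invr_ge0// mulrCA.
by apply: le_trans IH; rewrite ler_piMl ?mulr_ge0 ?ler0n// invf_le1// ler1n.
Qed.

(** * Positivity of the main terms *)

(** Induction on the size: a permutation matching the sets without x and y is corrected by the
    transposition of [pi x] and y. *)
Lemma exists_perm_imset (I : finType) (X Y : {set I}) : #|X| = #|Y| ->
  exists pi : {perm I}, pi @: X = Y.
Proof.
have [m] := ubnP #|X|; elim: m X Y => // m IH X Y Xm XY.
have [X0|[x xX]] := set_0Vmem X.
  exists 1%g; rewrite X0 imset0; apply/esym/eqP.
  by rewrite -cards_eq0 -XY X0 cards0.
have [Y0|[y yY]] := set_0Vmem Y.
  by move: XY; rewrite Y0 cards0 => /eqP; rewrite cards_eq0 => /eqP X0; rewrite X0 inE in xX.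
have [||pi piXY] := IH (X :\ x) (Y :\ y).
- by move: Xm; rewrite (cardsD1 x X) xX.
- by move: XY; rewrite (cardsD1 x X) xX (cardsD1 y Y) yY => -[].
exists (pi * tperm (pi x) y)%g.
have -> : X = x |: (X :\ x) by rewrite finset.setD1K.
rewrite imsetU1 permM tpermL.
have -> : [set (pi * tperm (pi x) y)%g z | z in X :\ x] = Y :\ y.
  rewrite -piXY; apply: eq_in_imset => z zX; rewrite permM tpermD//.
    by rewrite (inj_eq perm_inj) eq_sym; move: zX; rewrite !inE => /andP[].
  have : pi z \in Y :\ y by rewrite -piXY imset_f.
  by rewrite !inE eq_sym => /andP[].
by rewrite finset.setD1K.
Qed.

Lemma indep_imset (R : realType) (I V : finType) (P X : {set I}) (f : {set V} -> R) :
  [disjoint P & X] -> indep X (fun s : {ffun I -> V} => f [set s i | i in P]).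
Proof.
move=> PX s t st; congr f; apply: eq_in_imset => i iP.
by apply: st; apply: contraTN iP => iX; rewrite (disjointFl PX iX).
Qed.

(* Resampling the coordinates in [P :\: Q] and in [Q :\: P] independently turns
   the sum into a sum of squares, because [P :\: Q] and [Q :\: P] have the same
   cardinality. *)
Lemma imset_form_ge0 (R : realType) (I V : finType) (P Q : {set I})
    (w : {ffun I -> V} -> R) (f : {set V} -> R) :
  #|P| = #|Q| -> (forall s, 0 <= w s) -> indep (P :\: Q) w -> indep (Q :\: P) w ->
  0 <= \sum_(s : {ffun I -> V}) w s * f [set s i | i in P] * f [set s i | i in Q].
Proof.
move=> PQ w0 wX wY.
set X := P :\: Q in wX *; set Y := Q :\: P in wY *.
have XY : #|X| = #|Y|.
  have := cardsID Q P; have := cardsID P Q; rewrite finset.setIC PQ /X /Y; lia.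
have [pi piXY] := exists_perm_imset XY.
pose N : R := #|{ffun I -> V}|%:R.
pose h (s : {ffun I -> V}) := \sum_(t : {ffun I -> V}) f [set merge X s t i | i in P].
(* Relabelling t by [pi] carries the fresh values on X to those on Y. As f sees only the image set,
   both resampled sums agree. *)
have hE s : \sum_(t : {ffun I -> V}) f [set merge Y s t i | i in Q] = h s.
  pose c (t : {ffun I -> V}) : {ffun I -> V} := [ffun i => t (pi i)].
  have cinj : injective c.
    move=> t t' /ffunP tt'; apply/ffunP => i.
    by have := tt' (pi^-1 i)%g; rewrite !ffunE permKV.
  rewrite /h [RHS](reindex_inj cinj); apply: eq_bigr => t _; congr f.
  apply/setP => v; apply/imsetP/imsetP => -[i iP ->].
    case: (boolP (i \in P)) => [iP'|iP'].
      by exists i => //; rewrite !mergeE !inE iP iP'.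
    have iY : i \in Y by rewrite !inE iP iP'.
    have /imsetP[j jX ij] : i \in [set pi x | x in X] by rewrite piXY.
    exists j; first by move: jX; rewrite inE => /andP[].
    by rewrite !mergeE jX iY ffunE ij.
  case: (boolP (i \in Q)) => [iQ|iQ].
    by exists i => //; rewrite !mergeE !inE iP iQ.
  have iX : i \in X by rewrite !inE iP iQ.
  have piY : pi i \in Y by rewrite -piXY imset_f.
  exists (pi i); first by move: piY; rewrite inE => /andP[].
  by rewrite !mergeE iX piY ffunE.
have N0 : 0 <= N by rewrite ler0n.
(* Neither resampling changes w. X misses Q and Y misses P, so each affects only one factor f, and
   the double sum over t and t' is the square of [h s]. *)
have key : N * (N * \sum_(s : {ffun I -> V}) w s * f [set s i | i in P] * f [set s i | i in Q])
    = \sum_s w s * h s ^+ 2.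
  rewrite -(sum_merge X) /N -[RHS]mulr1 -(sum_merge Y) mulr1.
  apply: eq_bigr => s _; rewrite expr2 mulrA -{2}hE mulr_sumr; apply: eq_bigr => t _.
  rewrite /h mulr_sumr mulr_suml; apply: eq_bigr => t' _.
  have -> : w (merge X (merge Y s t) t') = w s.
    transitivity (w (merge Y s t)).
      by apply: wX => i iX; rewrite mergeE (negbTE iX).
    by apply: wY => i iX; rewrite mergeE (negbTE iX).
  congr (_ * f _ * f _); apply: eq_in_imset => i iP; rewrite !mergeE.
    by rewrite !inE iP/=.
  by rewrite !inE iP/=.
have [N0'|N0'] := eqVneq N 0.
  rewrite big_pred0// => s; exfalso.
  move/eqP: N0'; rewrite pnatr_eq0 => /eqP /card0_eq /(_ s); by rewrite inE.
have {}N0 : 0 < N by rewrite lt_def N0'.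
rewrite -(pmulr_rge0 _ N0) -(pmulr_rge0 _ N0) key.
by apply: sumr_ge0 => s _; rewrite mulr_ge0// sqr_ge0.
Qed.

Lemma prod_natb (R : realType) (J : Type) (s : seq J) (b : pred J) :
  \prod_(e <- s) (b e)%:R = (all b s)%:R :> R.
Proof.
elim: s => [|e s IH]; first by rewrite big_nil.
by rewrite big_cons IH /= -natrM mulnb.
Qed.

Definition kept (m : nat) (P Q : {set 'I_m}) : {set 'I_m * 'I_m} :=
  [set e | (e.1 \in P) && (e.1 \in Q) && (e.2 \notin P) && (e.2 \notin Q)].

(* A pair with both ends outside [P :|: Q] is counted once, in increasing order. *)
Definition loose (m : nat) (P Q : {set 'I_m}) : {set 'I_m * 'I_m} :=
  [set e | (e.1 \notin Q) && (e.2 \notin P)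
           && ((e.1 \notin P) && (e.2 \notin Q) ==> (e.1 < e.2)%N)].

(** Fix s on P, with image S. The kept edges ask each outside coordinate separately to lie in the
    common neighbourhood of S, which has at least d points wherever f S is nonzero. *)
Lemma kept_form_diag_ge (R : realType) (m : nat) (V : finType) (g : rel V) (d : R)
    (P : {set 'I_m}) (f : {set V} -> R) :
  0 <= d ->
  (forall S, f S != 0 -> d <= #|[set y | [forall v in S, g v y]]|%:R) ->
  d ^+ #|~: P| * \sum_(s : {ffun 'I_m -> V}) f [set s i | i in P] ^+ 2 <=
  #|V|%:R ^+ #|~: P| * \sum_(s : {ffun 'I_m -> V})
     edge_prod R g (enum (kept P P)) s * f [set s i | i in P] * f [set s i | i in P].
Proof.
move=> d0 fd.
have [V0|V0] := posnP #|{ffun 'I_m -> V}|.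
  by rewrite !big_pred0 ?mulr0// => s; have := card0_eq V0 s; rewrite inE.
have N0 : 0 < #|{ffun 'I_m -> V}|%:R :> R by rewrite ltr0n.
rewrite -(ler_pM2l N0) [leRHS]mulrCA -(sum_merge (~: P)).
have -> : #|{ffun 'I_m -> V}|%:R = #|V|%:R ^+ #|P| * #|V|%:R ^+ #|~: P| :> R.
  by rewrite card_ffun natrX -exprD cardsC.
rewrite -mulrA mulrCA ler_wpM2l ?exprn_ge0 ?ler0n//.
rewrite mulrA mulr_sumr; apply: ler_sum => s _.
set S := [set s i | i in P].
have -> : \sum_t edge_prod R g (enum (kept P P)) (merge (~: P) s t)
    * f [set merge (~: P) s t i | i in P] * f [set merge (~: P) s t i | i in P] =
    (\sum_t edge_prod R g (enum (kept P P)) (merge (~: P) s t)) * f S ^+ 2.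
  rewrite mulr_suml; apply: eq_bigr => t _; rewrite -mulrA -expr2.
  congr (_ * f _ ^+ _); apply: eq_in_imset => i iP.
  by rewrite mergeE inE iP.
have [->|fS0] := eqVneq (f S) 0; first by rewrite expr0n !mulr0.
rewrite ler_wpM2r ?sqr_ge0//.
have -> : \sum_t edge_prod R g (enum (kept P P)) (merge (~: P) s t) =
    \sum_(t : {ffun 'I_m -> V}) \prod_i
      (if i \in P then 1 else ([forall v in S, g v (t i)])%:R : R).
  apply: eq_bigr => t _; rewrite /edge_prod prod_natb.
  rewrite (eq_bigr (fun i => ((i \notin P) ==> [forall v in S, g v (t i)])%:R)); last first.
    by move=> i _; case: (i \in P).
  rewrite -big_enum prod_natb; congr (nat_of_bool _)%:R.
  apply/allP/allP => [h i _|h [z i]].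
    apply/implyP => iP; apply/forall_inP => v /imsetP[z zP ->].
    have := h (z, i); rewrite mem_enum inE /= zP iP !mergeE !inE zP iP; exact.
  rewrite mem_enum inE /= => /andP[/andP[/andP[zP _] iP] _].
  rewrite !mergeE !inE zP iP/=.
  have := h i; rewrite mem_enum iP => /(_ isT) /forall_inP; apply.
  exact: imset_f.
(* The sum over t factorises over coordinates. Those in P are ignored by [merge] and contribute a
   factor |V| each. *)
rewrite -(bigA_distr_bigA (fun i y => if i \in P then 1 else ([forall v in S, g v y])%:R : R)).
rewrite (bigID (mem P)) /=.
rewrite (eq_bigr (fun _ => #|V|%:R)); last first.
  by move=> i iP; rewrite iP sumr_const.
rewrite prodr_const [X in _ <= _ * X](eq_bigr (fun _ => #|[set y : V | [forall v in S, g v y]]|%:R)); last first.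
  move=> i iP; rewrite (negbTE iP) -natr_sum; congr _%:R.
  by rewrite -sum1_card [RHS]big_mkcond; apply: eq_bigr => y _; rewrite inE; case: ifP.
rewrite ler_wpM2l ?exprn_ge0 ?ler0n//.
rewrite (eq_bigl (mem (~: P))); last by move=> i; rewrite !inE.
rewrite prodr_const lerXn2r ?nnegrE ?ler0n//.
exact: fd.
Qed.

(** * Approximating the clique form *)

Definition hom_clique (m : nat) (V : finType) (g : rel V) (s : {ffun 'I_m -> V}) : bool :=
  [forall a, forall b, (a != b) ==> g (s a) (s b)].

(** Where both values of f are nonzero, the edges inside P and inside Q hold already. Every other
    pair of positions is, in some orientation, loose or kept. *)
Lemma hom_clique_split (R : realType) (m r : nat) (V : finType) (g : rel V)
    (P Q : {set 'I_m}) (f : {set V} -> R) (s : {ffun 'I_m -> V}) :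
  symmetric g -> #|P| = r -> #|Q| = r ->
  (forall S, f S != 0 -> #|S| = r /\ {in S &, forall x y, x != y -> g x y}) ->
  (hom_clique g s)%:R * f [set s i | i in P] * f [set s i | i in Q] =
  edge_prod R g (enum (loose P Q)) s * edge_prod R g (enum (kept P Q)) s
    * f [set s i | i in P] * f [set s i | i in Q].
Proof.
move=> gsym Pr Qr fcl.
have [->|fP0] := eqVneq (f [set s i | i in P]) 0; first by rewrite !mulr0 !mul0r.
have [->|fQ0] := eqVneq (f [set s i | i in Q]) 0; first by rewrite !mulr0.
congr (_ * _ * _); rewrite /edge_prod !prod_natb -natrM mulnb; congr (nat_of_bool _)%:R.
have inside (U : {set 'I_m}) : #|U| = r -> f [set s i | i in U] != 0 ->
    {in U &, forall a b, a != b -> g (s a) (s b)}.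
  move=> Ur fU a b aU bU ab; have [cU gU] := fcl _ fU.
  (* The support of f consists of r-sets, so s cannot merge two positions of U. *)
  have /imset_injP injU : #|[set s i | i in U]| == #|U| by rewrite cU Ur.
  apply: gU; rewrite ?imset_f//; apply: contraNneq ab => sab.
  by apply/eqP; apply: injU.
have {}gP := inside _ Pr fP0; have {}gQ := inside _ Qr fQ0.
apply/forallP/andP => [h|[/allP hL /allP hB] a].
  have h' a b : a != b -> g (s a) (s b) by move=> ab; have /forallP /(_ b) /implyP := h a; apply.
  split; apply/allP => -[a b]; rewrite mem_enum inE /= => hab; apply: h'.
    apply: contraTneq hab => ->; rewrite ltnn.
    by case: (b \in P); case: (b \in Q).
  by apply: contraTneq hab => ->; case: (b \in P); case: (b \in Q).
apply/forallP => b; apply/implyP => ab.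
have hL' x y : (x, y) \in loose P Q -> g (s x) (s y).
  by move=> h; apply: (hL (x, y)); rewrite mem_enum.
have hB' x y : (x, y) \in kept P Q -> g (s x) (s y).
  by move=> h; apply: (hB (x, y)); rewrite mem_enum.
have ltab : (a < b)%N || (b < a)%N by rewrite -neq_ltn.
have := gP a b; have := gQ a b.
have := hL' a b; have := hL' b a; have := hB' a b; have := hB' b a.
rewrite !inE /= ![g (s b) _]gsym.
case: (a \in P); case: (a \in Q); case: (b \in P); case: (b \in Q) => /=;
  rewrite ?andbT ?andbF /=; do ?[by move=> *; auto].
(* Both ends lie outside P and Q: only the increasing orientation is loose. *)
all: by case/orP: ltab => -> ? ? ? ? ? ?; auto.
Qed.

(** A loose pair is oriented with its first end outside Q and its second outside P, so f(s P)
    ignores the second and f(s Q) the first. This is what [telescope] requires. *)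
Lemma clique_form_approx (R : realType) (m r : nat) (V : finType) (g : rel V)
    (K : R) (P Q : {set 'I_m}) (f : {set V} -> R) :
  (0 < #|V|)%N -> bilinear_bound (fun x y => (g x y)%:R - 2^-1) K ->
  symmetric g -> #|P| = r -> #|Q| = r ->
  (forall S, f S != 0 -> #|S| = r /\ {in S &, forall x y, x != y -> g x y}) ->
  #|V|%:R * `|\sum_s (hom_clique g s)%:R * f [set s i | i in P] * f [set s i | i in Q]
    - 2^-1 ^+ #|loose P Q| * \sum_(s : {ffun 'I_m -> V}) edge_prod R g (enum (kept P Q)) s
        * f [set s i | i in P] * f [set s i | i in Q]|
  <= #|loose P Q|%:R * (K * (\sum_(s : {ffun 'I_m -> V}) f [set s i | i in P] ^+ 2
                           + \sum_(s : {ffun 'I_m -> V}) f [set s i | i in Q] ^+ 2)).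
Proof.
move=> V0 gK gsym Pr Qr fcl.
rewrite (eq_bigr _ (fun s _ => hom_clique_split s gsym Pr Qr fcl)).
rewrite cardE; apply: telescope => //.
- rewrite cat_uniq !enum_uniq andbT /=; apply/hasPn => -[a b].
  by rewrite !mem_enum !inE /=; case: (a \in Q); rewrite ?andbF.
- move=> [a b]; rewrite mem_enum inE /= => /andP[/andP[aQ bP] lt].
  split.
  + apply: contraTneq lt => ab; subst b; by rewrite aQ bP ltnn.
  + by apply: indep_imset; rewrite disjoint_sym disjoints1.
  + by apply: indep_imset; rewrite disjoint_sym disjoints1.
(* Only the reversed pair could meet both ends. If loose, it would put both ends outside P and Q,
   against the increasing order; if kept, it would put b in P. *)
- move=> [a b] [a' b']; rewrite mem_cat !mem_enum !inE /= /touches /=.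
  move=> /andP[/andP[aQ bP] lt] h ne; apply/negP => /andP[/orP ha /orP hb].
  have nab : a != b by apply: contraTneq lt => ab; subst b; rewrite aQ bP ltnn.
  case: ha => /eqP ?; case: hb => /eqP ?; subst.
  + by rewrite eqxx in nab.
  + by rewrite eqxx in ne.
  + case/orP: h => [/andP[/andP[h1 h2] h3]|].
      move: lt h3; rewrite aQ bP h1 h2 /= => lt h3.
      by have := ltn_trans lt h3; rewrite ltnn.
    by rewrite (negbTE bP).
  + by rewrite eqxx in nab.
Qed.

(** * The quadratic form of the matrix *)

Definition adj (n : nat) (G : {set {set 'I_n}}) : rel 'I_n :=
  fun x y => [set x; y]%SET \in G.

Lemma adj_sym (n : nat) (G : {set {set 'I_n}}) : symmetric (adj G).
Proof. by move=> x y; rewrite /adj finset.setUC. Qed.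

Lemma adj_irr (n : nat) (G : {set {set 'I_n}}) x : G \subset pairs n -> adj G x x = false.
Proof.
move=> GP; apply/negP => /(fintype.subsetP GP).
by rewrite inE finset.setUid cards1.
Qed.

(** A graph has no loops, so a homomorphism from a complete graph is injective. *)
Lemma hom_cliqueE (n m : nat) (G : {set {set 'I_n}}) (s : {ffun 'I_m -> 'I_n}) :
  G \subset pairs n ->
  hom_clique (adj G) s = injectiveb s && clique G [set s i | i : 'I_m].
Proof.
move=> GP; apply/idP/andP => [/forallP h|[/injectiveP si /forall_inP h]].
  have h' a b : a != b -> adj G (s a) (s b) by move=> ab; have /forallP /(_ b) /implyP := h a; apply.
  split.
    apply/injectiveP => a b sab; apply: contraTeq isT => /h'.
    by rewrite sab adj_irr.
  apply/forall_inP => x /imsetP[a _ ->]; apply/forall_inP => y /imsetP[b _ ->].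
  by apply/implyP => ab; apply: h'; apply: contraNneq ab => ->.
apply/forallP => a; apply/forallP => b; apply/implyP => ab.
have /forall_inP /(_ (s b) (imset_f _ _)) /implyP := h (s a) (imset_f _ isT).
by apply => //; rewrite (inj_eq si).
Qed.

Lemma card_hom_clique_onto (n m : nat) (G : {set {set 'I_n}}) (S : {set 'I_n}) :
  G \subset pairs n -> #|S| = m -> clique G S ->
  #|[set s : {ffun 'I_m -> 'I_n} | hom_clique (adj G) s && ([set s i | i : 'I_m] == S)]| = m`!.
Proof.
move=> GP Sm cS.
transitivity (#|S| ^_ #|'I_m|)%N; last by rewrite card_ord Sm ffactnn.
rewrite -card_inj_ffuns_on.
apply: eq_card => s; rewrite !inE hom_cliqueE//.
apply/andP/andP => [[/andP[si _] /eqP <-]|[/ffun_onP sS si]].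
  by split => //; apply/ffun_onP => i; exact: imset_f.
have sE : [set s i | i : 'I_m] = S.
  apply/eqP; rewrite eqEcard; apply/andP; split.
    by apply/fintype.subsetP => y /imsetP[i _ ->].
  by rewrite card_imset ?card_ord ?Sm//; exact/injectiveP.
by rewrite sE si eqxx.
Qed.

(** Group the labelled cliques by image: each clique on 2r vertices containing U has (2r)!
    labellings. *)
Lemma sum_hom_clique_above (R : realType) (n r : nat) (G : {set {set 'I_n}}) (U : {set 'I_n}) :
  G \subset pairs n ->
  \sum_(s : {ffun 'I_(2 * r) -> 'I_n})
     (hom_clique (adj G) s && (U \subset [set s i | i : 'I_(2 * r)]))%:R
  = ((2 * r)`! * deg r G U)%:R :> R.
Proof.
move=> GP; rewrite -natr_sum; congr _%:R.
pose im (s : {ffun 'I_(2 * r) -> 'I_n}) := [set s i | i : 'I_(2 * r)].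
pose D := [set S : {set 'I_n} | [&& U \subset S, #|S| == (2 * r)%N & clique G S]].
have -> : deg r G U = #|D| by [].
rewrite (eq_bigr (fun s => \sum_(S in D) (hom_clique (adj G) s && (im s == S)))%N).
  transitivity (\sum_(S in D) (2 * r)`!)%N; last by rewrite sum_nat_const mulnC.
  rewrite exchange_big /=; apply: eq_bigr => S; rewrite inE => /and3P[_ /eqP Sr cS].
  rewrite -[RHS](card_hom_clique_onto GP Sr cS) -sum1_card [RHS]big_mkcond /=.
  by apply: eq_bigr => s _; rewrite inE; case: ifP.
move=> s _; case: (boolP (hom_clique _ s)) => [hs|_]; last by rewrite big1.
have := hs; rewrite hom_cliqueE// => /andP[/injectiveP si cs].
have cim : #|im s| = (2 * r)%N by rewrite card_imset// card_ord.
have imD : (im s \in D) = (U \subset im s) by rewrite /D inE cim eqxx (cs : clique G (im s)) !andbT.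
rewrite /= -/(im s) -imD; case: (boolP (im s \in D)) => h.
  by rewrite (bigD1 (im s))//= eqxx big1// => S /andP[_]; rewrite eq_sym => /negbTE ->.
by rewrite big1// => S SD; case: eqP => // e; rewrite e SD in h.
Qed.

(** Under an injective s, only the preimages of I and J can contribute, and preimages preserve the
    size of the union. This trades vertex sets for position sets. *)
Lemma sum_preimage_pairs (R : realType) (n m r : nat) (beta : nat -> R)
    (s : {ffun 'I_m -> 'I_n}) (I J : {set 'I_n}) :
  injective s -> #|I| = r -> #|J| = r ->
  \sum_(P in rsets m r) \sum_(Q in rsets m r) beta #|P :|: Q|
     * (I == [set s i | i in P])%:R * (J == [set s i | i in Q])%:R
  = ((I :|: J) \subset [set s i | i : 'I_m])%:R * beta #|I :|: J|.
Proof.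
move=> si Ir Jr; rewrite finset.subUset.
have out (A : {set 'I_n}) (P : {set 'I_m}) : ~~ (A \subset [set s i | i : 'I_m]) ->
    (A == [set s i | i in P]) = false.
  move=> AS; apply: contraNF AS => /eqP ->.
  by apply/fintype.subsetP => y /imsetP[i _ ->]; exact: imset_f.
case: (boolP (I \subset _)) => [IS|IS]; last first.
  by rewrite mul0r big1// => P _; rewrite big1// => Q _; rewrite (out _ _ IS) mulr0 mul0r.
case: (boolP (J \subset _)) => [JS|JS]; last first.
  by rewrite mul0r big1// => P _; rewrite big1// => Q _; rewrite (out _ _ JS) mulr0.
have pre (A : {set 'I_n}) : A \subset [set s i | i : 'I_m] ->
    A = [set s i | i in s @^-1: A].
  move=> AS; apply/setP => y; apply/idP/imsetP => [yA|[i iA ->]].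
    have /imsetP[i _ yi] := fintype.subsetP AS y yA.
    by exists i; rewrite // inE -yi.
  by move: iA; rewrite inE.
have eqpre (A : {set 'I_n}) (P : {set 'I_m}) : A \subset [set s i | i : 'I_m] ->
    (A == [set s i | i in P]) = (P == s @^-1: A).
  move=> AS; apply/eqP/eqP => [->|->]; last exact: pre.
  by apply/setP => i; rewrite inE mem_imset.
have cpre (A : {set 'I_n}) : A \subset [set s i | i : 'I_m] -> #|s @^-1: A| = #|A|.
  by move=> AS; rewrite [in RHS](pre _ AS) card_imset.
rewrite (bigD1 (s @^-1: I)) /=; last by rewrite inE cpre// Ir.
rewrite [X in _ + X]big1 ?addr0; last first.
  move=> P /andP[_ nP]; rewrite big1// => Q _.
  by rewrite (eqpre _ _ IS) (negbTE nP) mulr0 mul0r.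
rewrite (bigD1 (s @^-1: J)) /=; last by rewrite inE cpre// Jr.
rewrite [X in _ + X]big1 ?addr0; last first.
  by move=> P /andP[_ nP]; rewrite (eqpre _ _ JS) (negbTE nP) mulr0.
rewrite !eqpre// !eqxx !mulr1 mul1r -preimsetU cpre// finset.subUset.
by rewrite IS JS.
Qed.

(** The vector x as a function on all vertex sets; off the r-sets the sum vanishes. Zeroing the
    non-cliques leaves the form unchanged, as subsets of cliques are cliques. *)
Definition clique_vec (R : realType) (n r : nat) (G : {set {set 'I_n}})
    (x : 'cV[R]_#|rsets n r|) (S : {set 'I_n}) : R :=
  if clique G S then \sum_i (enum_val i == S)%:R * x i 0 else 0.

Lemma MG_form (R : realType) (n r k : nat) (G : {set {set 'I_n}}) (x : 'cV[R]_#|rsets n r|) :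
  G \subset pairs n ->
  let f := clique_vec G x in
  (2 * r)`!%:R * (x^T *m MG R r k G *m x) 0 0 =
  \sum_(P in rsets (2 * r) r) \sum_(Q in rsets (2 * r) r)
    'C(k, #|P :|: Q|)%:R / 'C(2 * r, #|P :|: Q|)%:R *
    \sum_(s : {ffun 'I_(2 * r) -> 'I_n})
       (hom_clique (adj G) s)%:R * f [set s i | i in P] * f [set s i | i in Q].
Proof.
move=> GP f.
pose beta m : R := 'C(k, m)%:R / 'C(2 * r, m)%:R.
have sub_clique (s : {ffun 'I_(2 * r) -> 'I_n}) (P : {set 'I_(2 * r)}) :
    hom_clique (adj G) s -> f [set s i | i in P] = \sum_i (enum_val i == [set s i | i in P])%:R * x i 0.
  rewrite hom_cliqueE// => /andP[_ /forall_inP h]; rewrite /f /clique_vec ifT//.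
  apply/forall_inP => a aP; apply/forall_inP => b bP.
  have in_im y : y \in [set s i | i in P] -> y \in [set s i | i : 'I_(2 * r)].
    by move=> /imsetP[i _ ->]; exact: imset_f.
  by have /forall_inP := h a (in_im _ aP); apply; exact: in_im.
(* In this intermediate form (2r)! times each entry is written over labelled cliques and position
   sets; the rest is exchanging sums. *)
transitivity (\sum_i \sum_j x i 0 * x j 0 * \sum_(s : {ffun 'I_(2 * r) -> 'I_n})
   (hom_clique (adj G) s)%:R * \sum_(P in rsets (2 * r) r) \sum_(Q in rsets (2 * r) r)
    beta #|P :|: Q| * (enum_val i == [set s i | i in P])%:R * (enum_val j == [set s i | i in Q])%:R).
  rewrite mxE mulr_sumr exchange_big /=; apply: eq_bigr => j _.
  rewrite mxE mulr_suml mulr_sumr; apply: eq_bigr => i _.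
  rewrite !mxE.
  set U := (_ :|: _)%SET.
  have card_ev (i' : 'I_#|rsets n r|) : #|enum_val i'| = r.
    by have := enum_valP i'; rewrite inE => /eqP.
  rewrite (eq_bigr (fun s => (hom_clique (adj G) s && (U \subset [set s i | i : 'I_(2 * r)]))%:R * beta #|U|)).
    rewrite -mulr_suml sum_hom_clique_above// natrM /beta; ring.
  move=> s _; case: (boolP (hom_clique _ s)) => [hs|]; last by rewrite !mul0r.
  rewrite mul1r (sum_preimage_pairs (r := r))//.
  by apply/injectiveP; move: hs; rewrite hom_cliqueE// => /andP[].
under [RHS]eq_bigr do under eq_bigr do rewrite mulr_sumr.
under [RHS]eq_bigr do rewrite exchange_big /=.
rewrite [RHS]exchange_big /=.
under eq_bigr do under eq_bigr do rewrite mulr_sumr.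
under eq_bigr do rewrite exchange_big /=.
rewrite exchange_big /=; apply: eq_bigr => s _.
case: (boolP (hom_clique _ s)) => [hs|_]; last first.
  rewrite [LHS]big1 ?[RHS]big1// => P _; rewrite big1// => Q _; first by rewrite !mul0r mulr0.
  by rewrite mul0r mulr0.
under [RHS]eq_bigr do under eq_bigr do rewrite !sub_clique// mul1r mulr_suml mulr_sumr.
under [RHS]eq_bigr do rewrite exchange_big /=.
rewrite [RHS]exchange_big /=; apply: eq_bigr => i _.
under [RHS]eq_bigr do under eq_bigr do rewrite mulr_sumr mulr_sumr.
under [RHS]eq_bigr do rewrite exchange_big /=.
rewrite [RHS]exchange_big /=; apply: eq_bigr => j _.
rewrite mul1r mulr_sumr; apply: eq_bigr => P _.
rewrite mulr_sumr; apply: eq_bigr => Q _.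
by rewrite /beta; ring.
Qed.

(** * Positive semidefiniteness from pseudorandomness *)

Lemma bin_add_le (k r j : nat) : ('C(k, r + j) <= 'C(k, r) * k ^ j)%N.
Proof.
elim: j => [|j IH]; first by rewrite addn0 expn0 muln1.
rewrite addnS expnS mulnCA; apply: (@leq_trans (k * 'C(k, r + j))); last by rewrite leq_mul2l IH orbT.
apply: (@leq_trans ((r + j).+1 * 'C(k, (r + j).+1))); first by rewrite leq_pmull.
by rewrite mul_bin_left leq_mul2r leq_subr orbT.
Qed.

(** The factor C(k,r) is kept in the bound because it cancels against the same factor of the
    diagonal weight C(k,r) / C(2r,r). *)
Lemma bin_ratio_le (R : realType) (k r u : nat) : (r <= u <= 2 * r)%N ->
  'C(k, u)%:R / 'C(2 * r, u)%:R <= 'C(k, r)%:R * k%:R ^+ r :> R.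
Proof.
move=> /andP[ru u2r].
have C1 : 1 <= 'C(2 * r, u)%:R :> R by rewrite ler1n bin_gt0.
rewrite ler_pdivrMr ?(lt_le_trans ltr01)//.
rewrite -natrX -!natrM ler_nat.
have [->|k0] := posnP k.
  have [u0|u0] := posnP u; last by rewrite bin0n eqn0Ngt u0.
  by have r0 : r = 0%N by [lia]; rewrite u0 r0 !bin0.
have -> : u = (r + (u - r))%N by lia.
apply: leq_trans (bin_add_le _ _ _) _.
apply: (@leq_trans ('C(k, r) * k ^ r)).
  by rewrite leq_mul2l leq_pexp2l ?orbT// leq_subLR; lia.
by rewrite leq_pmulr// bin_gt0; lia.
Qed.

Lemma card_rsets (n r : nat) : #|rsets n r| = 'C(n, r).
Proof. by rewrite card_draws card_ord. Qed.

(** The numerical hypothesis says that the diagonal gain C(k,r)/C(2r,r) * n * 2^(-4r^2) * (d/n)^r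
    beats the total error C(k,r) k^r * 4r^2 K * 2 C(2r,r), after cancelling C(k,r). *)
Lemma MG_psd_of_pseudorandom (R : realType) (n r k : nat) (G : {set {set 'I_n}}) (K d : R) :
  (0 < n)%N -> G \subset pairs n -> 0 <= K -> 0 <= d ->
  bilinear_bound (fun x y => (adj G x y)%:R - 2^-1) K ->
  (forall I : {set 'I_n}, #|I| = r -> d <= #|[set y | [forall v in I, adj G v y]]|%:R) ->
  8 * r%:R ^+ 2 * k%:R ^+ r * 'C(2 * r, r)%:R ^+ 2 * K * 2 ^+ (4 * r ^ 2) * n%:R ^+ r
    <= n%:R * d ^+ r ->
  psdmx (MG R r k G).
Proof.
move=> n0 GP K0 d0 GK Gd param; split.
  by apply/matrixP => i j; rewrite !mxE finset.setUC.
move=> x; set q := (_ *m _) 0 0.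
have fact0 : 0 < (2 * r)`!%:R :> R by rewrite ltr0n fact_gt0.
rewrite -(pmulr_rge0 _ fact0) MG_form//=.
set f := clique_vec G x.
pose F (P : {set 'I_(2 * r)}) : R := \sum_(s : {ffun 'I_(2 * r) -> 'I_n}) f [set s i | i in P] ^+ 2.
set T := fun P Q : {set 'I_(2 * r)} => \sum_(s : {ffun 'I_(2 * r) -> 'I_n})
       (hom_clique (adj G) s)%:R * f [set s i | i in P] * f [set s i | i in Q].
(* There are at most (2r)^2 loose pairs, so [e] bounds the power of 1/2 from below. *)
pose e : R := 2^-1 ^+ (4 * r ^ 2).
have e0 : 0 < e by rewrite exprn_gt0// invr_gt0.
have N0 : 0 < n%:R :> R by rewrite ltr0n.
have Nr0 : 0 < n%:R ^+ r :> R by rewrite exprn_gt0.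
have F0 P : 0 <= F P by apply: sumr_ge0 => s _; exact: sqr_ge0.
have fcl S : f S != 0 -> #|S| = r /\ {in S &, forall x y, x != y -> adj G x y}.
  rewrite /f /clique_vec; case: ifP => [cS|]; last by rewrite eqxx.
  move=> nz; split.
    have : [exists i : 'I_#|rsets n r|, enum_val i == S].
      apply: contraNT nz => /existsPn h; apply/eqP; rewrite big1// => i _.
      by rewrite (negbTE (h i)) mul0r.
    by case/existsP => i /eqP <-; have := enum_valP i; rewrite inE => /eqP.
  move=> a b aS bS ab; have /forall_inP /(_ a aS) /forall_inP /(_ b bS) /implyP := cS.
  exact.
have looseP (P Q : {set 'I_(2 * r)}) : (#|loose P Q| <= 4 * r ^ 2)%N.
  apply: leq_trans (max_card _) _; by rewrite card_prod !card_ord -mulnn mulnACA.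
pose E := 4 * r%:R ^+ 2 * K : R.
(* For P != Q the main term is only used to be nonnegative; for P = Q it gives the diagonal gain. *)
have lower (P Q : {set 'I_(2 * r)}) : #|P| = r -> #|Q| = r ->
    (P == Q)%:R * (n%:R * e * d ^+ r / n%:R ^+ r * F P) - E * (F P + F Q) <= n%:R * T P Q.
  move=> Pr Qr.
  have ap := clique_form_approx (r := r) (f := f) (P := P) (Q := Q) (V := 'I_n) (g := adj G) (K := K).
  have {}ap : n%:R * (2^-1 ^+ #|loose P Q| * \sum_(s : {ffun 'I_(2 * r) -> 'I_n})
      edge_prod R (adj G) (enum (kept P Q)) s * f [set s i | i in P] * f [set s i | i in Q])
      - E * (F P + F Q) <= n%:R * T P Q.
    have := ap _ GK (@adj_sym _ G) Pr Qr fcl; rewrite card_ord => /(_ n0).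
    rewrite -/(T P Q) -/(F P) -/(F Q) => h.
    have : #|loose P Q|%:R * (K * (F P + F Q)) <= E * (F P + F Q).
      rewrite mulrA ler_wpM2r ?addr_ge0// /E ler_wpM2r//.
      by rewrite -natrX -natrM ler_nat.
    move=> /(le_trans h); rewrite -[n%:R in X in X -> _]gtr0_norm// -normrM mulrBr.
    rewrite ler_norml => /andP[]; lra.
  apply: le_trans ap; rewrite lerD2r.
  case: eqP => [PQ|_]; last first.
    rewrite mul0r; apply: mulr_ge0; first exact: ltW.
    apply: mulr_ge0; first by rewrite exprn_ge0 ?invr_ge0.
    (* Kept edges have ends in both of P and Q or in neither, so they ignore the positions in
       exactly one. *)
    have ind (X : {set 'I_(2 * r)}) : {in X, forall i, (i \in P) != (i \in Q)} ->
        indep X (edge_prod R (adj G) (enum (kept P Q))).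
      move=> hX s t st; rewrite /edge_prod big_seq [RHS]big_seq.
      apply: eq_bigr => -[a b]; rewrite mem_enum inE /= => /andP[/andP[/andP[aP aQ] bP] bQ].
      rewrite !st//; [apply/negP => /hX | apply/negP => /hX].
        by rewrite (negbTE bP) (negbTE bQ).
      by rewrite aP aQ.
    apply: imset_form_ge0 => [|s||]; first by rewrite Pr Qr.
    + by rewrite /edge_prod; apply: prodr_ge0 => *; rewrite ler0n.
    + by apply: ind => i; rewrite !inE => /andP[/negbTE -> ->].
    + by apply: ind => i; rewrite !inE => /andP[/negbTE -> ->].
  rewrite mul1r -PQ -!mulrA ler_pM2l//.
  have cP : #|~: P| = r.
    by apply/eqP; rewrite -(eqn_add2l r) -{1}Pr cardsC card_ord mul2n addnn.
  have := @kept_form_diag_ge R (2 * r) 'I_n (adj G) d P f d0.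
  rewrite cP card_ord -/(F P) => diag.
  set M := \sum_(s : {ffun 'I_(2 * r) -> 'I_n}) _ in diag *.
  have {}diag : d ^+ r / n%:R ^+ r * F P <= M.
    rewrite mulrAC ler_pdivrMr// [M * _]mulrC; apply: diag => S /fcl[Sr _].
    exact: Gd.
  have M0 : 0 <= M by apply: le_trans diag; rewrite mulr_ge0// divr_ge0 ?exprn_ge0// ltW.
  apply: ler_pM; rewrite ?(ltW e0)//.
  - by apply: mulr_ge0; [exact: exprn_ge0|apply: mulr_ge0 => //; rewrite invr_ge0 ltW].
  - by rewrite /e ler_wiXn2l// ?invr_ge0// invf_le1// ler1n.
  - by rewrite mulrA.
set bt := fun u : nat => 'C(k, u)%:R / 'C(2 * r, u)%:R : R.
pose Bm : R := 'C(k, r)%:R * k%:R ^+ r.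
have bt0 u : 0 <= bt u by rewrite divr_ge0 ?ler0n.
have Bm0 : 0 <= Bm by rewrite mulr_ge0 ?exprn_ge0 ?ler0n.
have E0 : 0 <= E by rewrite !mulr_ge0// sqr_ge0.
pose SF := \sum_(P in rsets (2 * r) r) F P.
have SF0 : 0 <= SF by apply: sumr_ge0.
rewrite -(pmulr_rge0 _ N0).
(* Summing [F P + F Q] over all pairs of r-sets counts each [F P] 2 C(2r,r) times. *)
apply: (@le_trans _ _ (bt r * (n%:R * e * d ^+ r / n%:R ^+ r) * SF - Bm * E * (2 * 'C(2 * r, r)%:R * SF))).
  rewrite subr_ge0 [leLHS]mulrA.
  rewrite ler_wpM2r// /bt /Bm.
  have C0 : 0 < 'C(2 * r, r)%:R :> R by rewrite ltr0n bin_gt0 leq_pmull.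
  rewrite -!mulrA ler_wpM2l ?ler0n//.
  rewrite ler_pdivlMl// [leRHS](_ : _ = n%:R * e * d ^+ r / n%:R ^+ r); last by rewrite !mulrA.
  rewrite ler_pdivlMr// -(ler_pM2r (_ : 0 < 2 ^+ (4 * r ^ 2))) ?exprn_gt0//.
  have ee : e * 2 ^+ (4 * r ^ 2) = 1 by rewrite /e -exprMn mulVf ?expr1n.
  rewrite [leRHS](_ : _ = n%:R * d ^+ r * (e * 2 ^+ (4 * r ^ 2))); last by ring.
  rewrite ee mulr1; apply: le_trans param.
  by rewrite le_eqVlt /E; apply/orP; left; apply/eqP; ring.
rewrite [leRHS]mulr_sumr.
apply: (@le_trans _ _ (\sum_(P in rsets (2 * r) r) \sum_(Q in rsets (2 * r) r)
   (bt #|P :|: Q| * ((P == Q)%:R * (n%:R * e * d ^+ r / n%:R ^+ r * F P)) - Bm * E * (F P + F Q)))).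
  rewrite le_eqVlt; apply/orP; left; apply/eqP.
  under [RHS]eq_bigr do rewrite sumrB.
  rewrite sumrB; congr (_ - _).
    rewrite {1}/SF mulr_sumr; apply: eq_bigr => P Pr.
    rewrite (bigD1 P)//= eqxx mul1r finset.setUid big1 ?addr0; last first.
      by move=> Q /andP[_ QP]; rewrite eq_sym (negbTE QP) mul0r mulr0.
    by move: Pr; rewrite inE => /eqP ->; rewrite !mulrA.
  under [RHS]eq_bigr do rewrite -mulr_sumr.
  rewrite -mulr_sumr; congr (_ * _).
  under [RHS]eq_bigr do rewrite big_split /= sumr_const card_rsets -/SF.
  rewrite big_split /= sumr_const card_rsets sumrMnl -/SF.
  by rewrite -[RHS]mulr2n -(mulr_natl SF) -[RHS]mulr_natl mulrA.
apply: ler_sum => P Pr; rewrite [leRHS]mulr_sumr; apply: ler_sum => Q Qr.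
rewrite -/(T P Q) -/(bt _).
have := lower P Q; move: Pr Qr; rewrite !inE => /eqP Pr /eqP Qr /(_ Pr Qr) h.
rewrite [leRHS]mulrCA; apply: le_trans (ler_wpM2l (bt0 _) h).
rewrite mulrBr lerD2l lerN2 mulrA; apply: ler_wpM2r; first by rewrite addr_ge0.
apply: ler_wpM2r => //; apply: bin_ratio_le.
have /subset_leq_card := finset.subsetUl P Q; rewrite Pr => ->.
by rewrite /=; apply: leq_trans (leq_card_setU P Q) _; rewrite Pr Qr mul2n addnn.
Qed.

(** * Exponential moments of the random graph *)

(** Expand the product over all of T, with values 0 and 1 off D: every G not inside D then
    contributes zero. *)
Lemma sum_subset_prod (R : realType) (T : finType) (D : {set T}) (F H : T -> R) :
  \sum_(G : {set T} | G \subset D) \prod_(e in D) (if e \in G then F e else H e)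
  = \prod_(e in D) (F e + H e).
Proof.
pose F' e := if e \in D then F e else 0; pose H' e := if e \in D then H e else 1.
transitivity (\prod_e (F' e + H' e)); last first.
  rewrite [RHS]big_mkcond; apply: eq_bigr => e _; rewrite /F' /H'.
  by case: ifP => // _; rewrite add0r.
rewrite bigA_distr big_mkcond; apply: eq_bigr => G _.
case: ifP => [GD|/negbT GD].
  rewrite big_mkcond; apply: eq_bigr => e _; rewrite /F' /H'.
  case: ifP => [//|/negbT eD]; case: ifP => // eG.
  by rewrite (fintype.subsetP GD) in eD.
have /subsetPn[e eG eD] := GD.
by rewrite (bigD1 e)//= eG /F' (negbTE eD) mul0r.
Qed.

Definition gnp_E (R : realType) (n : nat) (Y : {set {set 'I_n}} -> R) : R :=
  \sum_(G : {set {set 'I_n}} | G \subset pairs n) gnp_weight 2^-1 G * Y G.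

Lemma half_compl (R : realType) : 1 - 2^-1 = 2^-1 :> R. Proof. by field. Qed.

Lemma gnp_weight_half_ge0 (R : realType) (n : nat) (G : {set {set 'I_n}}) :
  0 <= gnp_weight (2^-1 : R) G.
Proof. by apply: prodr_ge0 => e _; rewrite half_compl; case: ifP; rewrite invr_ge0. Qed.

Lemma gnp_weight_half_sum (R : realType) (n : nat) :
  \sum_(G : {set {set 'I_n}} | G \subset pairs n) gnp_weight (2^-1 : R) G = 1.
Proof.
rewrite sum_subset_prod big1// => e _; by field.
Qed.

Lemma gnp_Pr_le1 (R : realType) (n : nat) (A : {set {set 'I_n}} -> Prop) :
  gnp_Pr (2^-1 : R) A <= 1.
Proof.
rewrite -[leRHS](gnp_weight_half_sum R n) /gnp_Pr [leLHS]big_mkcondr.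
by apply: ler_sum => G _; case: ifP => // _; exact: gnp_weight_half_ge0.
Qed.

(** Markov's inequality: Y dominates the indicator of failure. *)
Lemma gnp_Pr_ge (R : realType) (n : nat) (A : {set {set 'I_n}} -> Prop)
    (Y : {set {set 'I_n}} -> R) :
  (forall G, 0 <= Y G) -> (forall G : {set {set 'I_n}}, G \subset pairs n -> ~ A G -> 1 <= Y G) ->
  1 - gnp_E Y <= gnp_Pr (2^-1 : R) A.
Proof.
move=> Y0 YA; rewrite lerBlDr -[leLHS](gnp_weight_half_sum R n) /gnp_Pr big_mkcondr -big_split /=.
apply: ler_sum => G GP; have w0 := gnp_weight_half_ge0 R G.
case: ifP => [_|/negbT/asboolPn nA]; first by rewrite lerDl mulr_ge0.
by rewrite add0r ler_peMr// YA.
Qed.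

Lemma gnp_E_sum (R : realType) (n : nat) (J : finType) (P : pred J)
    (Y : J -> {set {set 'I_n}} -> R) :
  gnp_E (fun G => \sum_(j | P j) Y j G) = \sum_(j | P j) gnp_E (Y j).
Proof. by rewrite exchange_big; apply: eq_bigr => G _; rewrite mulr_sumr. Qed.

Lemma gnp_EZ (R : realType) (n : nat) (c : R) (Y : {set {set 'I_n}} -> R) :
  gnp_E (fun G => c * Y G) = c * gnp_E Y.
Proof. by rewrite /gnp_E mulr_sumr; apply: eq_bigr => G _; rewrite mulrCA. Qed.

Lemma gnp_ED (R : realType) (n : nat) (Y Y' : {set {set 'I_n}} -> R) :
  gnp_E (fun G => Y G + Y' G) = gnp_E Y + gnp_E Y'.
Proof. by rewrite /gnp_E -big_split; apply: eq_bigr => G _; rewrite mulrDr. Qed.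

Lemma gnp_E_prod (R : realType) (n : nat) (F H : {set 'I_n} -> R) :
  gnp_E (fun G => \prod_(e in pairs n) (if e \in G then F e else H e))
  = \prod_(e in pairs n) ((F e + H e) / 2).
Proof.
rewrite /gnp_E (eq_bigr (fun G : {set {set 'I_n}} =>
   \prod_(e in pairs n) (if e \in G then F e / 2 else H e / 2))).
  by rewrite sum_subset_prod; apply: eq_bigr => e _; rewrite mulrDl.
move=> G _; rewrite /gnp_weight -big_split; apply: eq_bigr => e _ /=.
by rewrite half_compl; case: ifP; rewrite mulrC.
Qed.

(** For |y| <= 1/2, exp y <= 1/(1-y) <= 1 + y + 2y^2. Averaging over the two signs cancels the
    linear term. *)
Lemma cosh_le (R : realType) (z : R) : `|z| <= 2^-1 ->
  (expR z + expR (- z)) / 2 <= expR (2 * z ^+ 2).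
Proof.
have ub (y : R) : `|y| <= 2^-1 -> expR y <= 1 + y + 2 * y ^+ 2.
  rewrite ler_norml => /andP[y1 y2].
  have h1 : 0 < 1 - y by lra.
  have h2 : 1 - y <= expR (- y) by apply: le_trans (expR_ge1Dx _); lra.
  have -> : expR y = (expR (- y))^-1 by rewrite -expRN opprK.
  apply: (@le_trans _ _ (1 - y)^-1); first by rewrite lef_pV2 ?posrE ?expR_gt0.
  rewrite -[leLHS]mul1r ler_pdivrMr//; nra.
move=> hz; have h1 := ub _ hz; have h2 := ub (- z).
rewrite normrN in h2; have {}h2 := h2 hz.
apply: le_trans (expR_ge1Dx _); rewrite sqrrN in h2; lra.
Qed.

(** S and T may overlap, so an edge can be counted once per orientation. *)
Definition edge_mult (n : nat) (S T : {set 'I_n}) (e : {set 'I_n}) : nat :=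
  #|[set q in finset.setX S T | [set q.1; q.2]%SET == e]|.

Lemma edge_mult_le2 (n : nat) (S T e : {set 'I_n}) : e \in pairs n ->
  (edge_mult S T e <= 2)%N.
Proof.
rewrite inE => /eqP e2; rewrite -e2 /edge_mult.
rewrite -(card_in_imset (f := fun q : 'I_n * 'I_n => q.1)); last first.
  move=> [a b] [a' b']; rewrite !inE /= => /andP[_ /eqP h1] /andP[_ /eqP h2] aa'; subst a'.
  congr pair.
  have ab : a != b by apply: contra_eq_neq e2 => ab; rewrite -h1 ab finset.setUid cards1.
  have : b \in [set a; b']%SET by rewrite h2 -h1 !inE eqxx orbT.
  by rewrite !inE eq_sym (negbTE ab) /= => /eqP.
apply: subset_leq_card; apply/fintype.subsetP => x /imsetP[[a b]].
by rewrite !inE /= => /andP[_ /eqP <-] ->; rewrite !inE eqxx.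
Qed.

Lemma sum_edge_mult_le (n : nat) (S T : {set 'I_n}) :
  (\sum_(e in pairs n) edge_mult S T e <= #|S| * #|T|)%N.
Proof.
rewrite -cardsX -sum1_card.
rewrite (eq_bigr (fun e => \sum_(q in finset.setX S T) ([set q.1; q.2]%SET == e))%N).
  rewrite exchange_big; apply: leq_sum => q _.
  have [h|h] := boolP ([set q.1; q.2]%SET \in pairs n).
    by rewrite (bigD1 [set q.1; q.2]%SET)//= eqxx big1// => e /andP[_]; rewrite eq_sym => /negbTE ->.
  by rewrite big1// => e ep; case: eqP => // E; rewrite E ep in h.
move=> e _; rewrite /edge_mult -sum1_card [LHS](eq_bigl (fun q => (q \in finset.setX S T) && ([set q.1; q.2]%SET == e))).
  by rewrite big_mkcondr; apply: eq_bigr => q _; case: ifP.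
by move=> q; rewrite !inE.
Qed.

(** Diagonal entries are the constant -1/2; without them the sum is centred. *)
Definition cut_offdiag (R : realType) (n : nat) (G : {set {set 'I_n}}) (S T : {set 'I_n}) : R :=
  \sum_(x in S) \sum_(y in T | y != x) ((adj G x y)%:R - 2^-1).

Lemma cut_offdiagE (R : realType) (n : nat) (G : {set {set 'I_n}}) (S T : {set 'I_n}) :
  cut_offdiag R G S T =
  \sum_(e in pairs n) (edge_mult S T e)%:R * (if e \in G then 2^-1 else - 2^-1).
Proof.
rewrite /cut_offdiag pair_big_dep /=.
rewrite (partition_big (fun q : 'I_n * 'I_n => [set q.1; q.2]%SET) (mem (pairs n))) /=; last first.
  by move=> [x y] /= /andP[_ /andP[_ yx]]; rewrite inE cards2 [x == y]eq_sym yx.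
apply: eq_bigr => e ep.
rewrite (eq_bigr (fun _ => if e \in G then 2^-1 else - 2^-1)).
  rewrite sumr_const mulr_natl; congr (_ *+ _); apply: eq_card => -[x y].
  rewrite !inE /=; apply/andP/andP => [[/andP[-> /andP[-> _]] ->]//|[/andP[-> ->] /eqP h]].
  rewrite h; split => //=.
  by apply: contraTneq ep => yx; rewrite -h yx inE finset.setUid cards1.
move=> [x y] /= /andP[_ /eqP <-]; rewrite /adj; case: (_ \in G) => /=; by field.
Qed.

(** Edges are independent, so the moment is a product of cosh(lam * mu / 2) with mu = [edge_mult] at
    most 2. Each factor is at most exp(lam^2 mu^2 / 2) <= exp(lam^2 mu), and the mu add up to at
    most |S||T|. *)
Lemma cut_exp_moment (R : realType) (n : nat) (S T : {set 'I_n}) (lam : R) :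
  `|lam| <= 2^-1 ->
  gnp_E (fun G => expR (lam * cut_offdiag R G S T)) <= expR (lam ^+ 2 * (#|S| * #|T|)%:R).
Proof.
move=> lamle.
have -> : gnp_E (fun G => expR (lam * cut_offdiag R G S T)) =
   \prod_(e in pairs n) ((expR (lam * (edge_mult S T e)%:R / 2)
                        + expR (- (lam * (edge_mult S T e)%:R / 2))) / 2).
  rewrite -gnp_E_prod; apply: eq_bigr => G _; congr (_ * _).
  rewrite cut_offdiagE mulr_sumr expR_sum; apply: eq_bigr => e _.
  by case: ifP => _; congr expR; field.
apply: (@le_trans _ _ (\prod_(e in pairs n) expR (2 * (lam * (edge_mult S T e)%:R / 2) ^+ 2))).
  apply: ler_prod => e ep; apply/andP; split.
    by rewrite divr_ge0 ?addr_ge0 ?expR_ge0.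
  apply: cosh_le; rewrite -mulrA normrM -[leRHS]mulr1.
  apply: ler_pM => //; rewrite ger0_norm ?divr_ge0//.
  by rewrite ler_pdivrMr// mul1r ler_nat edge_mult_le2.
rewrite -expR_sum ler_expR.
apply: (@le_trans _ _ (lam ^+ 2 * (\sum_(e in pairs n) edge_mult S T e)%:R)); last first.
  by rewrite ler_wpM2l ?sqr_ge0// ler_nat sum_edge_mult_le.
rewrite natr_sum mulr_sumr; apply: ler_sum => e ep.
have m2 : (edge_mult S T e)%:R <= 2 :> R by rewrite ler_nat edge_mult_le2.
have -> : 2 * (lam * (edge_mult S T e)%:R / 2) ^+ 2
   = lam ^+ 2 * ((edge_mult S T e)%:R * ((edge_mult S T e)%:R / 2)) by field.
rewrite ler_wpM2l ?sqr_ge0// ler_piMr//.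
by rewrite ler_pdivrMr// mul1r.
Qed.

(** * Common neighbourhoods *)

Definition codeg (n : nat) (G : {set {set 'I_n}}) (I : {set 'I_n}) : nat :=
  #|[set y | [forall v in I, adj G v y]]|.

Lemma gnp_E_subset (R : realType) (n : nat) (F : {set {set 'I_n}}) : F \subset pairs n ->
  gnp_E (fun G => (F \subset G)%:R) = 2^-1 ^+ #|F| :> R.
Proof.
move=> FP.
transitivity (gnp_E (fun G : {set {set 'I_n}} =>
    \prod_(e in pairs n) (if e \in G then 1 else (e \notin F)%:R) : R)).
  apply: eq_bigr => G _; congr (_ * _).
  case: (boolP (F \subset G)) => [FG|/subsetPn[e eF eG]].
    rewrite big1// => e _; case: ifP => // /negbT eG.
    by rewrite (contraNN _ eG)//; apply: (fintype.subsetP FG).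
  by rewrite (bigD1 e) ?(fintype.subsetP FP)//= (negbTE eG) eF mul0r.
rewrite (gnp_E_prod (fun=> 1) (fun e => (e \notin F)%:R)).
rewrite (bigID (mem F)) /= [X in _ * X]big1 ?mulr1; last first.
  by move=> e /andP[_ eF]; rewrite (eF : e \notin F) /=; field.
rewrite (eq_bigr (fun _ => 2^-1)); last by move=> e /andP[_ ->]; rewrite addr0 mul1r.
rewrite (eq_bigl (mem F)) ?prodr_const//.
move=> e; apply/andP/idP => [[]//|eF]; split => //; exact: (fintype.subsetP FP).
Qed.

Definition star_edges (n : nat) (I J : {set 'I_n}) : {set {set 'I_n}} :=
  [set [set q.1; q.2]%SET | q in finset.setX I J].

Lemma card_star_edges (n : nat) (I J : {set 'I_n}) : [disjoint I & J] ->
  #|star_edges I J| = (#|I| * #|J|)%N.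
Proof.
move=> IJ; rewrite card_in_imset ?cardsX// => -[a b] [a' b'].
rewrite !inE /= => /andP[aI bJ] /andP[aI' bJ'] /setP E.
have ne x y : x \in I -> y \in J -> (x == y) = false.
  by move=> xI yJ; apply: contraTF xI => /eqP ->; rewrite (disjointFl IJ yJ).
have := E a; have := E b; rewrite !inE !eqxx /= orbT (ne a b')// [b == a']eq_sym (ne a' b)//.
by rewrite orbF /= => /esym/eqP -> /esym/eqP ->.
Qed.

Lemma star_edges_pairs (n : nat) (I J : {set 'I_n}) : [disjoint I & J] ->
  star_edges I J \subset pairs n.
Proof.
move=> IJ; apply/fintype.subsetP => e /imsetP[[a b]]; rewrite !inE /= => /andP[aI bJ] ->.
rewrite cards2; have -> // : a != b.
by apply: contraTneq aI => ->; rewrite (disjointFl IJ bJ).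
Qed.

(** Write 2^(-codeg) as the product over t of 1 - h/2, with h the indicator that t is a common
    neighbour, and expand over sets J. For J disjoint from I, all of J are common neighbours with
    probability 2^(-|I||J|); resumming gives the product form. *)
Lemma gnp_E_codeg (R : realType) (n : nat) (I : {set 'I_n}) : (0 < #|I|)%N ->
  gnp_E (fun G => 2^-1 ^+ codeg G I) = (1 - 2^-1 ^+ #|I|.+1) ^+ (n - #|I|) :> R.
Proof.
move=> /card_gt0P[v0 v0I].
pose h (G : {set {set 'I_n}}) t := [forall v in I, adj G v t].
pose F G t : R := if t \in I then 0 else - 2^-1 * (h G t)%:R.
pose F' (t : 'I_n) : R := if t \in I then 0 else - 2^-1 ^+ #|I|.+1.
transitivity (gnp_E (fun G : {set {set 'I_n}} =>
    \sum_(J : {set 'I_n}) \prod_(t in J) F G t)).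
  apply: eq_bigr => G GP; congr (_ * _).
  transitivity (\prod_t (F G t + 1)); last first.
    by rewrite bigA_distr; apply: eq_bigr => J _; rewrite [RHS]big_mkcond.
  rewrite /codeg -prodr_const big_mkcond; apply: eq_bigr => t _.
  rewrite inE /F -/(h G t); case: (boolP (t \in I)) => [tI|_].
    rewrite add0r ifN//; apply/negP => /forall_inP /(_ t tI).
    by rewrite adj_irr.
  by case: (h G t) => /=; field.
rewrite gnp_E_sum.
transitivity (\sum_(J : {set 'I_n}) \prod_(t in J) F' t); last first.
  transitivity (\prod_t (F' t + 1)).
    by rewrite bigA_distr; apply: eq_bigr => J _; rewrite [LHS]big_mkcond.
  rewrite (bigID (mem I)) /= big1 ?mul1r; last by move=> t tI; rewrite /F' tI add0r.
  rewrite (eq_bigr (fun=> 1 - 2^-1 ^+ #|I|.+1)); last first.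
    by move=> t /negbTE tI; rewrite /F' tI addrC.
  rewrite (eq_bigl (mem (~: I))); last by move=> t; rewrite !inE.
  by rewrite prodr_const; congr (_ ^+ _); rewrite cardsCs finset.setCK card_ord.
apply: eq_bigr => J _.
have [dIJ|] := boolP [disjoint I & J]; last first.
  rewrite -setI_eq0 => /set0Pn[t]; rewrite inE => /andP[tI tJ].
  rewrite [RHS](bigD1 t)//= /F' tI mul0r /gnp_E big1// => G _.
  by rewrite (bigD1 t)//= /F tI mul0r mulr0.
have tJI t : t \in J -> (t \in I) = false by move=> tJ; rewrite (disjointFl dIJ tJ).
transitivity (gnp_E (fun G : {set {set 'I_n}} =>
    (- 2^-1) ^+ #|J| * (star_edges I J \subset G)%:R : R)).
  apply: eq_bigr => G _; congr (_ * _).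
  rewrite (eq_bigr (fun t => - 2^-1 * (h G t)%:R)); last by move=> t /tJI tI; rewrite /F tI.
  rewrite big_split /= prodr_const -big_enum prod_natb; congr (_ * (nat_of_bool _)%:R).
  apply/allP/fintype.subsetP => [H e /imsetP[[a b]]|H t].
    rewrite !inE /= => /andP[aI bJ] ->.
    by have := H b; rewrite mem_enum bJ => /(_ isT) /forall_inP /(_ a aI).
  rewrite mem_enum => tJ; apply/forall_inP => v vI; apply: H.
  by apply/imsetP; exists (v, t) => //; rewrite inE /= vI tJ.
rewrite gnp_EZ gnp_E_subset ?star_edges_pairs// card_star_edges//.
rewrite (eq_bigr (fun=> - 2^-1 ^+ #|I|.+1)); last by move=> t /tJI tI; rewrite /F' tI.
by rewrite prodr_const exprM -exprMn exprS mulNr.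
Qed.

(** * Bad events *)

Lemma expR_nat_ge (R : realType) (m : nat) : 2 ^+ m <= expR m%:R :> R.
Proof.
rewrite -[m%:R]mulr1 expRM_natl lerXn2r ?nnegrE ?expR_ge0//.
by have := expR_ge1Dx (1 : R); lra.
Qed.

(* Chernoff parameter: [lam ^ 2 * p = n / 4] and [lam * 8 * sqrt (n * p) = 4 * n]. *)
Definition cut_rate (R : realType) (n p : nat) : R := Num.sqrt n%:R / (2 * Num.sqrt p%:R).

(** A Chernoff union bound as one random variable: a large cut, of either sign, makes one summand at
    least 1. Pairs with |S||T| < n need no randomness. *)
Definition cut_bad (R : realType) (n : nat) (G : {set {set 'I_n}}) : R :=
  \sum_(q : {set 'I_n} * {set 'I_n} | (n <= #|q.1| * #|q.2|)%N)
    expR (- (4 * n%:R)) *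
    (expR (cut_rate R n (#|q.1| * #|q.2|) * cut_offdiag R G q.1 q.2)
     + expR (- cut_rate R n (#|q.1| * #|q.2|) * cut_offdiag R G q.1 q.2)).

Lemma cut_bad_ge0 (R : realType) (n : nat) (G : {set {set 'I_n}}) : 0 <= cut_bad R G.
Proof. by apply: sumr_ge0 => q _; rewrite mulr_ge0 ?addr_ge0 ?expR_ge0. Qed.

(** Each of at most 4^n pairs contributes at most 2 exp(-4n + n/4) <= 2 * 2^(-3n). The restriction
    |S||T| >= n keeps the rate at most 1/2. *)
Lemma cut_bad_E (R : realType) (n : nat) : (0 < n)%N ->
  gnp_E (fun G : {set {set 'I_n}} => cut_bad R G) <= 2 * 2^-1 ^+ n.
Proof.
move=> n0; rewrite gnp_E_sum.
have n0R : 0 < n%:R :> R by rewrite ltr0n.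
apply: (@le_trans _ _ (\sum_(q : {set 'I_n} * {set 'I_n}) 2 * 2^-1 ^+ (3 * n))); last first.
  have cset : #|{set 'I_n}| = (2 ^ n)%N by rewrite -cardsT -powersetT card_powerset cardsT card_ord.
  rewrite sumr_const card_prod cset -[leLHS]mulr_natl.
  rewrite natrM natrX exprM mulrCA ler_pM2l// -!exprMn lerXn2r ?nnegrE//; lra.
rewrite big_mkcond; apply: ler_sum => -[S T] _ /=.
case: ifP => [np|_]; last by rewrite mulr_ge0// exprn_ge0 ?invr_ge0.
have p0 : (0 < #|S| * #|T|)%N by apply: leq_trans np.
set p := (#|S| * #|T|)%N in np p0 *.
have sp0 : 0 < Num.sqrt p%:R :> R by rewrite sqrtr_gt0 ltr0n.
have lam0 : 0 <= cut_rate R n p by rewrite divr_ge0 ?mulr_ge0 ?sqrtr_ge0.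
have lamle : `|cut_rate R n p| <= 2^-1.
  rewrite ger0_norm// ler_pdivrMr ?mulr_gt0// mulrA mulVf// mul1r.
  by rewrite ler_sqrt ?ler0n// ler_nat.
have lam2 : cut_rate R n p ^+ 2 * p%:R = n%:R / 4.
  rewrite /cut_rate expr_div_n exprMn !sqr_sqrtr ?ler0n//.
  by field; rewrite pnatr_eq0 -lt0n.
have b1 := cut_exp_moment S T lamle; rewrite lam2 in b1.
have b2 : gnp_E (fun G => expR (- cut_rate R n p * cut_offdiag R G S T)) <= expR (n%:R / 4).
  have := @cut_exp_moment R n S T (- cut_rate R n p).
  by rewrite normrN sqrrN lam2; apply.
rewrite gnp_EZ gnp_ED.
apply: (@le_trans _ _ (expR (- (4 * n%:R)) * (expR (n%:R / 4) + expR (n%:R / 4)))).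
  by rewrite ler_wpM2l ?expR_ge0// lerD.
rewrite -mulr2n -[_ *+ 2]mulr_natl mulrCA ler_pM2l// -expRD.
apply: (@le_trans _ _ (expR (- (3 * n)%:R))).
  by rewrite ler_expR natrM; lra.
by rewrite expRN exprVn lef_pV2 ?posrE ?expR_gt0 ?exprn_gt0// expR_nat_ge.
Qed.

(** The cut constant 9 covers 8 for the off-diagonal part and 1/2 for the diagonal;
    [bilinear_of_cut] doubles it to 18. *)
Lemma bilinear_of_cut_bad (R : realType) (n : nat) (G : {set {set 'I_n}}) :
  (0 < n)%N -> G \subset pairs n -> cut_bad R G < 1 ->
  bilinear_bound (fun x y => (adj G x y)%:R - 2^-1)
    (18 * Num.sqrt n%:R * (1 + ln n%:R) : R).
Proof.
move=> n0 GP bad.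
have n0R : 0 < n%:R :> R by rewrite ltr0n.
have sn0 : 0 < Num.sqrt n%:R :> R by rewrite sqrtr_gt0.
have := @bilinear_of_cut R 'I_n (fun x y => (adj G x y)%:R - 2^-1) (9 * Num.sqrt n%:R).
rewrite card_ord => /(_ n0) h.
rewrite (_ : 18 * Num.sqrt n%:R = 2 * (9 * Num.sqrt n%:R)); last by ring.
apply: h; first by rewrite mulr_gt0.
move=> S T; set p := (#|S| * #|T|)%N.
set X := \sum_(x in S) _.
rewrite -mulrA -sqrtrM ?ler0n// -natrM -/p.
have trivial_le : `|X| <= p%:R.
  apply: le_trans (ler_norm_sum _ _ _) _.
  rewrite /p -sum_nat_const natr_sum; apply: ler_sum => x _.
  apply: le_trans (ler_norm_sum _ _ _) _.
  rewrite -sum1_card natr_sum; apply: ler_sum => y _.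
  by case: (adj G x y) => /=; rewrite ler_norml; apply/andP; split; lra.
have spp : p%:R = Num.sqrt p%:R * Num.sqrt p%:R :> R by rewrite -expr2 sqr_sqrtr.
have sp0 : 0 <= Num.sqrt p%:R :> R by exact: sqrtr_ge0.
(* For p < n the trivial bound p = sqrt p * sqrt p suffices. *)
have [np|pn] := leqP n p; last first.
  apply: le_trans trivial_le _; rewrite {1}spp ler_wpM2r//.
  apply: (@le_trans _ _ (Num.sqrt n%:R)); first by rewrite ler_sqrt ?ler0n// ler_nat ltnW.
  lra.
have XZ : X = cut_offdiag R G S T - 2^-1 * #|S :&: T|%:R.
  rewrite /X /cut_offdiag -sum1_card natr_sum mulr_sumr.
  rewrite [X in _ - X](eq_bigl (fun x => (x \in S) && (x \in T))); last by move=> x; rewrite inE.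
  rewrite big_mkcondr -sumrB; apply: eq_bigr => x _.
  case: ifP => [xT|xT].
    rewrite (bigD1 x)//= adj_irr// addrC mulr1 sub0r; congr (_ - _).
  by rewrite subr0; apply: eq_bigl => y; rewrite andb_idr// => yT; apply: contraTneq yT => ->; rewrite xT.
have capp : #|S :&: T|%:R <= Num.sqrt n%:R * Num.sqrt p%:R :> R.
  apply: (@le_trans _ _ (Num.sqrt p%:R)).
    rewrite -(@ler_pXn2r _ 2)// ?nnegrE ?ler0n// sqr_sqrtr ?ler0n// -natrX ler_nat -mulnn.
    by rewrite leq_mul// subset_leq_card// ?finset.subsetIl ?finset.subsetIr.
  rewrite ler_peMl//; rewrite -[leLHS](sqrtr1 R) ler_sqrt ?ler0n//.
  by rewrite ler1n.
have Zle : `|cut_offdiag R G S T| <= 8 * (Num.sqrt n%:R * Num.sqrt p%:R).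
  rewrite leNgt; apply/negP => big; move: bad; apply/negP; rewrite -leNgt.
  have p0 : (0 < p)%N by apply: leq_trans np.
  have sp1 : 0 < Num.sqrt p%:R :> R by rewrite sqrtr_gt0 ltr0n.
  have rate0 : 0 < cut_rate R n p by rewrite divr_gt0// mulr_gt0.
  have rateb : 4 * n%:R <= cut_rate R n p * `|cut_offdiag R G S T|.
    apply: (@le_trans _ _ (cut_rate R n p * (8 * (Num.sqrt n%:R * Num.sqrt p%:R)))); last first.
      by rewrite ler_pM2l// ltW.
    have nn : n%:R = Num.sqrt n%:R * Num.sqrt n%:R :> R by rewrite -expr2 sqr_sqrtr.
    rewrite {1}nn /cut_rate le_eqVlt; apply/orP; left; apply/eqP; field.
    by rewrite gt_eqF.
  rewrite /cut_bad (bigD1 (S, T))//= -/p -[leLHS]addr0 lerD//; last first.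
    by apply: sumr_ge0 => q _; rewrite mulr_ge0 ?addr_ge0 ?expR_ge0.
  rewrite expRN ler_pdivlMl ?expR_gt0// mulr1.
  have [Z0|Z0] := leP 0 (cut_offdiag R G S T).
    rewrite -[leLHS]addr0 lerD ?expR_ge0// ler_expR.
    by rewrite (ger0_norm Z0) in rateb.
  rewrite -[leLHS]add0r lerD ?expR_ge0// ler_expR mulNr -mulrN.
  by rewrite (ltr0_norm Z0) in rateb.
rewrite XZ; apply: le_trans (ler_normB _ _) _.
rewrite [`|2^-1 * _|]ger0_norm ?mulr_ge0 ?ler0n//.
have c0 : 0 <= #|S :&: T|%:R :> R by rewrite ler0n.
by rewrite -mulrA; move: Zle capp c0; lra.
Qed.

(** A set I with at most m common neighbours makes its summand at least 1. *)
Definition codeg_bad (R : realType) (n r m : nat) (G : {set {set 'I_n}}) : R :=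
  \sum_(I in rsets n r) 2 ^+ m * 2^-1 ^+ codeg G I.

Lemma codeg_bad_ge0 (R : realType) (n r m : nat) (G : {set {set 'I_n}}) :
  0 <= codeg_bad R r m G.
Proof. by apply: sumr_ge0 => q _; rewrite mulr_ge0 ?exprn_ge0 ?invr_ge0. Qed.

Lemma codeg_bad_E (R : realType) (n r m : nat) : (0 < r)%N ->
  gnp_E (fun G : {set {set 'I_n}} => codeg_bad R r m G)
    <= n%:R ^+ r * (2 ^+ m * (1 - 2^-1 ^+ r.+1) ^+ (n - r)).
Proof.
move=> r0; rewrite gnp_E_sum.
rewrite (eq_bigr (fun=> 2 ^+ m * (1 - 2^-1 ^+ r.+1) ^+ (n - r))); last first.
  by move=> I; rewrite inE => /eqP Ir; rewrite gnp_EZ gnp_E_codeg Ir.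
rewrite sumr_const -[leLHS]mulr_natl ler_wpM2r//.
  by rewrite mulr_ge0 ?exprn_ge0// subr_ge0 exprn_ile1// ?invr_ge0// invf_le1// ler1n.
by rewrite -natrX ler_nat card_rsets; have := bin_add_le n 0 r; rewrite add0n bin0 mul1n.
Qed.

Lemma codeg_gt_of_bad (R : realType) (n r m : nat) (G : {set {set 'I_n}}) :
  codeg_bad R r m G < 1 -> forall I : {set 'I_n}, #|I| = r -> (m < codeg G I)%N.
Proof.
move=> bad I Ir; rewrite ltnNge; apply/negP => le; move: bad; apply/negP; rewrite -leNgt.
rewrite /codeg_bad (bigD1 I) ?inE ?Ir//= -[leLHS]addr0 lerD//; last first.
  by apply: sumr_ge0 => q _; rewrite mulr_ge0 ?exprn_ge0 ?invr_ge0.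
rewrite -(subnK le) exprD -mulrA -exprMn mulfV// expr1n mulr1.
by rewrite exprn_ege1// ler1n.
Qed.

(** * Parameters *)

Lemma bin_le_exp2 (n r : nat) : ('C(n, r) <= 2 ^ n)%N.
Proof.
rewrite -card_rsets; apply: leq_trans (max_card _) _.
by rewrite -cardsT -powersetT card_powerset cardsT card_ord.
Qed.

Lemma pow_r_bound (R : realType) (r k : nat) (W : R) : (0 < r)%N -> 0 <= W ->
  k%:R <= 2 `^ (- (40 * r%:R)) * (W `^ (r%:R^-1)) ->
  2 ^+ (40 * r ^ 2) * k%:R ^+ r <= W.
Proof.
move=> r0 W0 hk.
have rR : r%:R != 0 :> R by rewrite pnatr_eq0 -lt0n.
have : k%:R ^+ r <= (2 `^ (- (40 * r%:R)) * (W `^ (r%:R^-1))) ^+ r.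
  by rewrite lerXn2r// ?nnegrE ?ler0n// mulr_ge0 ?powR_ge0.
rewrite exprMn -[(W `^ _) ^+ r]powR_mulrn ?powR_ge0// -powRrM mulVf// powRr1//.
rewrite powRN -natrM powR_mulrn// exprVn -exprM => h.
rewrite -mulnn mulnA.
rewrite -(ler_pM2l (_ : 0 < (2 ^+ (40 * r * r))^-1 :> R)) ?invr_gt0 ?exprn_gt0//.
by rewrite mulrA mulVf ?mul1r// expf_neq0.
Qed.

(** With r^2 <= 2^(2r), C(2r,r) <= 2^(2r) and 36 <= 2^6, the exponents add up to 5r^2 + 9r + 9 <=
    40r^2. *)
Lemma const_bound (r : nat) : (0 < r)%N ->
  (8 * r ^ 2 * 'C(2 * r, r) ^ 2 * 36 * 2 ^ (4 * r ^ 2) * 2 ^ ((r + 3) * r) <= 2 ^ (40 * r ^ 2))%N.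
Proof.
move=> r0.
apply: (@leq_trans (2 ^ 3 * 2 ^ (2 * r) * 2 ^ (4 * r) * 2 ^ 6 * 2 ^ (4 * r ^ 2) * 2 ^ ((r + 3) * r))).
  rewrite !leq_mul//.
    by rewrite mulnC expnM leq_exp2r// ltnW// ltn_expl.
  have -> : (4 * r = 2 * r * 2)%N by lia.
  by rewrite expnM leq_exp2r// bin_le_exp2.
rewrite -!expnD leq_exp2l// -mulnn; nia.
Qed.

(** With d = n / 2^(r+3), n^r cancels and one factor sqrt n is left to absorb k^r * ln n. As ln n >=
    1, 18 (1 + ln n) <= 36 ln n, the 36 of [const_bound]. *)
Lemma param_bound (R : realType) (n r k : nat) : (0 < r)%N -> expR 1 <= n%:R :> R ->
  2 ^+ (40 * r ^ 2) * k%:R ^+ r <= Num.sqrt n%:R / ln n%:R :> R ->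
  8 * r%:R ^+ 2 * k%:R ^+ r * 'C(2 * r, r)%:R ^+ 2 * (18 * Num.sqrt n%:R * (1 + ln n%:R))
    * 2 ^+ (4 * r ^ 2) * n%:R ^+ r <= n%:R * (n%:R / 2 ^+ (r + 3)) ^+ r :> R.
Proof.
move=> r0 en hk.
have n0 : 0 < n%:R :> R by apply: lt_le_trans en; rewrite expR_gt0.
have L1 : 1 <= ln n%:R :> R by rewrite -ler_expR lnK// posrE.
have L0 : 0 < ln n%:R :> R by apply: lt_le_trans L1.
set s := Num.sqrt n%:R in hk *; set L := ln n%:R in hk L1 L0 *.
have s0 : 0 < s by rewrite sqrtr_gt0.
have ss : n%:R = s * s :> R by rewrite -expr2 sqr_sqrtr// ltW.
have P0 : 0 < 2 ^+ ((r + 3) * r) :> R by rewrite exprn_gt0.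
rewrite expr_div_n -exprM [leRHS]mulrA ler_pdivlMr//.
rewrite (_ : _ * n%:R ^+ r * _ = 8 * r%:R ^+ 2 * k%:R ^+ r * 'C(2 * r, r)%:R ^+ 2
   * (18 * s * (1 + L)) * 2 ^+ (4 * r ^ 2) * 2 ^+ ((r + 3) * r) * n%:R ^+ r); last by rewrite mulrAC.
rewrite ler_pM2r ?exprn_gt0//.
have C := const_bound r0; rewrite -(ler_nat R) !natrM !natrX in C.
rewrite ler_pdivlMr// in hk.
have kr0 : 0 <= k%:R ^+ r :> R by rewrite exprn_ge0.
set A := 8 * r%:R ^+ 2 * 'C(2 * r, r)%:R ^+ 2 * 2 ^+ (4 * r ^ 2) * 2 ^+ ((r + 3) * r) : R.
have A0 : 0 <= A by rewrite /A !mulr_ge0// ?sqr_ge0// exprn_ge0.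
rewrite [leLHS](_ : _ = A * 18 * (1 + L) * (k%:R ^+ r * s)); last by rewrite /A; ring.
have {}C : A * 36 <= 2 ^+ (40 * r ^ 2).
  by apply: le_trans C; rewrite le_eqVlt /A; apply/orP; left; apply/eqP; ring.
apply: (@le_trans _ _ (2 ^+ (40 * r ^ 2) * k%:R ^+ r * L * s)); last by rewrite ss ler_pM2r.
rewrite [leRHS](_ : _ = 2 ^+ (40 * r ^ 2) * L * (k%:R ^+ r * s)); last by ring.
rewrite ler_wpM2r//; first by rewrite mulr_ge0// ltW.
apply: (@le_trans _ _ (A * 36 * L)); last by rewrite ler_pM2r.
rewrite -[leLHS]mulrA -[leRHS]mulrA; apply: ler_wpM2l => //; lra.
Qed.

(** Put Q = 2^(r+3). The factors are at most exp(sqrt n), exp(n/Q) and exp(-2n/Q), and n/Q >= 2 sqrt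
    n. *)
Lemma codeg_bad_small (R : realType) (n r : nat) : (0 < r)%N -> expR 1 <= n%:R :> R ->
  2 ^+ (40 * r ^ 2) <= Num.sqrt n%:R / ln n%:R :> R ->
  n%:R ^+ r * (2 ^+ (n %/ 2 ^ (r + 3)) * (1 - 2^-1 ^+ r.+1) ^+ (n - r))
    <= expR (- Num.sqrt n%:R) :> R.
Proof.
move=> r0 en hD.
have n0 : 0 < n%:R :> R by apply: lt_le_trans en; rewrite expR_gt0.
have L1 : 1 <= ln n%:R :> R by rewrite -ler_expR lnK// posrE.
have L0 : 0 < ln n%:R :> R by apply: lt_le_trans L1.
rewrite ler_pdivlMr// in hD.
have -> : n%:R ^+ r = expR (r%:R * ln n%:R) :> R by rewrite expRM_natl lnK// posrE.
set s := Num.sqrt n%:R in hD *; set L := ln n%:R in hD L1 L0 *.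
have s0 : 0 < s by rewrite sqrtr_gt0.
have ss : n%:R = s * s :> R by rewrite -expr2 sqr_sqrtr// ltW.
set D := 2 ^+ (40 * r ^ 2) in hD.
have D0 : 0 < D by rewrite exprn_gt0.
have D1 : D <= s by apply: le_trans hD; rewrite ler_peMr// ltW.
have r4 : 2 ^+ (r + 4) <= D by rewrite ler_eXn2l ?ltr1n// -mulnn; nia.
have rle : r%:R * 2 <= D.
  apply: le_trans r4; rewrite exprD; apply: ler_pM => //.
    by rewrite -natrX ler_nat ltnW// ltn_expl.
  by rewrite -natrX ler_nat.
set Q := 2 ^+ (r + 3) : R.
have Q0 : 0 < Q by rewrite exprn_gt0.
have QD : 2 * Q <= D by apply: le_trans r4; rewrite addnS exprS.
set m := (n %/ _)%N.
have mA : m%:R <= n%:R / Q.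
  by rewrite ler_pdivlMr// /Q -natrX -natrM ler_nat leq_divM.
have A2 : 2 * s <= n%:R / Q.
  rewrite ler_pdivlMr// ss; move: QD D1 s0; nra.
have s1 : 1 <= s by apply: le_trans D1; rewrite exprn_ege1// ler1n.
have rn : r%:R * 2 <= n%:R :> R.
  apply: le_trans rle _; apply: le_trans D1 _; rewrite ss ler_peMr//; exact: ltW.
have rn' : (r <= n)%N.
  by apply: leq_trans (leq_pmulr r (isT : 0 < 2)%N) _; rewrite -(ler_nat R) natrM.
have x0 : 0 <= 1 - 2^-1 ^+ r.+1 :> R by rewrite subr_ge0 exprn_ile1// ?invr_ge0// invf_le1// ler1n.
have step : (1 - 2^-1 ^+ r.+1) ^+ (n - r) <= expR (- (2 * (n%:R / Q))) :> R.
  apply: (@le_trans _ _ (expR (- 2^-1 ^+ r.+1) ^+ (n - r))).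
    by rewrite lerXn2r// ?nnegrE ?expR_ge0// expR_ge1Dx.
  rewrite -expRM_natl ler_expR mulrN lerN2 natrB//.
  have -> : 2 * (n%:R / Q) = (n%:R / 2) * 2^-1 ^+ r.+1.
    rewrite /Q exprVn (_ : (r + 3 = r.+1 + 2)%N); last by rewrite addn2 addn3.
    by rewrite exprD; field; rewrite expf_neq0.
  by rewrite ler_wpM2r ?exprn_ge0 ?invr_ge0//; lra.
apply: (@le_trans _ _ (expR (r%:R * L) * (expR m%:R * expR (- (2 * (n%:R / Q)))))).
  rewrite ler_wpM2l ?expR_ge0//; apply: ler_pM => //; rewrite ?exprn_ge0//.
  exact: expR_nat_ge.
rewrite -!expRD ler_expR.
have rL : r%:R * L <= s.
  apply: le_trans hD; rewrite ler_pM2r//; apply: le_trans rle; rewrite ler_peMr//; lra.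
by move: rL mA A2; lra.
Qed.

(** * The probability estimate and its limit *)

Lemma MG_psd_k0 (R : realType) (n r : nat) (G : {set {set 'I_n}}) : (0 < r)%N ->
  psdmx (MG R r 0 G).
Proof.
move=> r0; have -> : MG R r 0 G = 0.
  apply/matrixP => i j; rewrite !mxE /= bin0n.
  have : (0 < #|enum_val i :|: enum_val j|)%N.
    have := enum_valP i; rewrite inE => /eqP ir.
    by apply: leq_trans (subset_leq_card (finset.subsetUl _ _)); rewrite ir.
  by rewrite lt0n => /negbTE ->; rewrite mulr0 mul0r.
split; first by rewrite trmx0.
by move=> x; rewrite mulmx0 mul0mx mxE.
Qed.

(** One good event serves all k at once, and the error does not depend on r, so r may vary with
    n. *)
Lemma gnp_Pr_psd_ge (R : realType) (n r : nat) : (0 < r)%N -> expR 1 <= n%:R :> R ->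
  1 - 3 * Num.sqrt (n.+1%:R^-1) <=
  gnp_Pr (2^-1 : R) (fun G : {set {set 'I_n}} => forall k : nat,
    k%:R <= 2 `^ (- (40 * r%:R)) * ((Num.sqrt n%:R / ln n%:R) `^ (r%:R^-1)) :> R ->
    psdmx (MG R r k G)).
Proof.
move=> r0 en.
have n0 : 0 < n%:R :> R by apply: lt_le_trans en; rewrite expR_gt0.
have n0N : (0 < n)%N by rewrite -(ltr0n R).
have L1 : 1 <= ln n%:R :> R by rewrite -ler_expR lnK// posrE.
set W := Num.sqrt n%:R / ln n%:R.
have W0 : 0 <= W by rewrite divr_ge0 ?sqrtr_ge0// (le_trans _ L1).
(* If r is too large for n, only k = 0 meets the bound, and the matrix is then zero for every
   graph. *)
have [hD|hD] := lerP (2 ^+ (40 * r ^ 2)) W; last first.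
  apply: le_trans (gnp_Pr_ge (Y := fun=> 0) _ _) => //.
    rewrite /gnp_E big1 ?subr0; last by move=> G _; rewrite mulr0.
    by rewrite gerBl mulr_ge0 ?sqrtr_ge0.
  move=> G _; case => k /(pow_r_bound r0 W0) hk.
  have [->|k0] := posnP k; first exact: MG_psd_k0.
  exfalso; move: hD; apply/negP; rewrite -leNgt; apply: le_trans hk.
  by rewrite ler_peMr ?exprn_ge0// exprn_ege1// ler1n.
pose m := (n %/ 2 ^ (r + 3))%N.
apply: le_trans (gnp_Pr_ge (Y := fun G => cut_bad R G + codeg_bad R r m G) _ _).
- rewrite gnp_ED lerB//.
  have E1 := cut_bad_E R n0N; have E2 := codeg_bad_E R n m r0.
  have E3 := codeg_bad_small r0 en hD; rewrite -/m in E3.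
  have sn0 : 0 < Num.sqrt n.+1%:R :> R by rewrite sqrtr_gt0.
  have sE : Num.sqrt (n.+1%:R^-1) = (Num.sqrt n.+1%:R)^-1 :> R by rewrite sqrtrV.
  have s1 : 1 <= Num.sqrt n.+1%:R :> R by rewrite -[leLHS](sqrtr1 R) ler_sqrt// ler1n.
  have F1 : 2^-1 ^+ n <= Num.sqrt (n.+1%:R^-1) :> R.
    rewrite sE exprVn lef_pV2 ?posrE ?exprn_gt0//.
    apply: (@le_trans _ _ n.+1%:R); last by rewrite -natrX ler_nat ltn_expl.
    by rewrite -[leRHS](sqr_sqrtr (ler0n R n.+1)) expr2 ler_peMr// ltW.
  have F2 : expR (- Num.sqrt n%:R) <= Num.sqrt (n.+1%:R^-1) :> R.
    rewrite sE expRN lef_pV2 ?posrE ?expR_gt0//; apply: le_trans (expR_ge1Dx _).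
    have t0 : 0 <= Num.sqrt n%:R :> R by exact: sqrtr_ge0.
    rewrite -(@ler_pXn2r _ 2)// ?nnegrE ?addr_ge0 ?sqrtr_ge0//.
    rewrite sqr_sqrtr ?ler0n// sqrrD sqr_sqrtr ?ler0n// -(natr1 n) expr1n mul1r.
    by move: (n%:R) t0 => x; lra.
  have {}E2 := le_trans E2 E3.
  by move: E1 E2 F1 F2; lra.
- by move=> G; rewrite addr_ge0 ?cut_bad_ge0 ?codeg_bad_ge0.
move=> G GP nA; rewrite leNgt; apply/negP => bad; apply: nA => k hk.
have cb0 := cut_bad_ge0 R G; have db0 := codeg_bad_ge0 R r m G.
have bad1 : cut_bad R G < 1 by apply: le_lt_trans bad; rewrite lerDl.
have bad2 : codeg_bad R r m G < 1 by apply: le_lt_trans bad; rewrite lerDr.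
have Q0 : 0 < 2 ^+ (r + 3) :> R by rewrite exprn_gt0.
apply: (@MG_psd_of_pseudorandom R n r k G (18 * Num.sqrt n%:R * (1 + ln n%:R)) (n%:R / 2 ^+ (r + 3))) => //.
- by rewrite !mulr_ge0 ?sqrtr_ge0// addr_ge0// (le_trans _ L1).
- exact: bilinear_of_cut_bad.
- move=> I Ir; rewrite ler_pdivrMr// -natrX -natrM ler_nat.
  (* Strictly more than m common neighbours make up for the rounding down in m. *)
  apply: (@leq_trans (m.+1 * 2 ^ (r + 3))); first by rewrite ltnW// ltn_ceil// expn_gt0.
  by rewrite leq_mul2r (codeg_gt_of_bad bad2 Ir) orbT.
exact: param_bound r0 en (pow_r_bound r0 W0 hk).
Qed.

Local Open Scope classical_set_scope.

Theorem mainTheorem4 (R : realType) :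
  exists c : R, 0 < c /\
    forall r : nat -> nat, (forall n, (0 < r n)%N) ->
      (fun n : nat =>
         gnp_Pr (2^-1 : R) (fun G : {set {set 'I_n}} =>
           forall k : nat,
             k%:R <= 2 `^ (- (c * (r n)%:R))
                     * ((Num.sqrt n%:R / ln n%:R) `^ ((r n)%:R^-1)) :> R ->
             psdmx (MG R (r n) k G)))
        @ \oo --> (1 : R).
Proof.
(* The constant 40 is the exponent in [const_bound]. *)
exists 40; split => // r r0.
apply: (@squeeze_cvgr _ _ _ _ (fun n => 1 - 3 * Num.sqrt (n.+1%:R^-1)) (fun=> 1)).
- near=> n; rewrite gnp_Pr_le1 andbT; apply: gnp_Pr_psd_ge => //.
  near: n; exact: nbhs_infty_ger.
- have lim0 : (fun n : nat => 1 - 3 * Num.sqrt (n.+1%:R^-1) : R) @ \oo --> 1 - 3 * Num.sqrt (0 : R).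
    apply: cvgB; first exact: cvg_cst.
    apply: cvgM; first exact: cvg_cst.
    by apply: (continuous_cvg _ (@sqrt_continuous R 0)); exact: cvg_harmonic.
  by rewrite sqrtr0 mulr0 subr0 in lim0.
- exact: cvg_cst.
Unshelve. all: by end_near.
Qed.
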